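(* Let $G$ be a finite non-solvable $\mathbf{GC}^*$-group. Then $G = G'$.
   Context: Galois automorphisms act on characters by $\chi^\alpha(g)=\chi(g)^\alpha$; two irreducible characters of $G$ are Galois conjugate if one is the image of the other under some element of $\mathrm{Gal}(\mathbb{Q}_n|\mathbb{Q})$ with $|G|$ dividing $n$. A finite group is a $\mathbf{GC}^*$-group if any two of its non-linear irreducible characters of the same degree are Galois conjugate. *)

(* Defs.v *)
From mathcomp Require Import all_boot all_algebra all_fingroup all_solvable all_field all_character.
Set Implicit Arguments. Unset Strict Implicit. Unset Printing Implicit Defensive.
Import GRing.Theory Num.Theory.
Local Open Scope ring_scope.

(* Two irreducible characters are Galois conjugate if one is the image of the
   other under a field automorphism of algC (equivalently, under an element of
   Gal(Q_n/Q) with |G| dividing n, since character values lie in Q_|G| and every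
   automorphism of Q_n extends to algC). *)
Definition galois_conjugate (gT : finGroupType) (G : {group gT})
  (chi psi : 'CF(G)) : Prop :=
  exists u : {rmorphism algC -> algC}, cfAut u chi = psi.

Definition GCstar (gT : finGroupType) (G : {group gT}) : Prop :=
  forall i j : Iirr G,
    'chi_i 1%g != 1 -> 'chi_j 1%g != 1 ->
    'chi_i 1%g = 'chi_j 1%g -> galois_conjugate 'chi_i 'chi_j.

(* Main.v *)
Require Import Defs.
From mathcomp Require Import all_boot all_algebra all_fingroup all_solvable all_field all_character.
Set Implicit Arguments. Unset Strict Implicit. Unset Printing Implicit Defensive.
Import GroupScope FiniteModule GRing.Theory Num.Theory.

(** Suppose G' < G and let p be a prime divisor of |G : G'|. Galois conjugate
    characters have determinants of the same order, whereas a nonlinear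
    character of degree prime to p can be multiplied by linear characters so
    as to change the p-part of the order of its determinant. Hence p divides
    the degree of every nonlinear irreducible character, and G has a normal
    p-complement N by Thompson's counting argument. If theta in Irr(N) is
    nonlinear with inertia group T, the canonical extension of theta to T can
    be multiplied by the linear characters of T / N before inducing to G; the
    resulting irreducible characters have the same degree, but the one
    obtained from the canonical extension itself is Galois conjugate to none
    of the others, by uniqueness of canonical extensions; so T = N. An element
    g of order p thus fixes no nonlinear irreducible character of N, which
    makes g act on N' without nontrivial fixed points. By Thompson's theorem
    N' is then nilpotent, and G is solvable. *)

(** * Normal p-complements *)

(** A normal [p]-complement, when there is one, is the [p']-core; this makes its existence a
    decidable condition. *)
Definition p_nilpotent (gT : finGroupType) (p : nat) (G : {set gT}) : bool :=
  p^'.-Hall(G) 'O_p^'(G).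

Section PNilpotent.

Variables (gT : finGroupType) (p : nat).
Implicit Types G H K P Q X : {group gT}.

Lemma normal_complement_p_nilpotent G K :
  p^'.-Hall(G) K -> K <| G -> p_nilpotent p G.
Proof. by move=> hallK nsKG; rewrite /p_nilpotent (normal_Hall_pcore hallK). Qed.

Lemma p_nilpotentS G H : H \subset G -> p_nilpotent p G -> p_nilpotent p H.
Proof.
move=> sHG nilG; have nsKG := pcore_normal p^' G.
apply: (@normal_complement_p_nilpotent _ ('O_p^'(G) :&: H)%G).
  exact: setI_normal_Hall nilG sHG.
by rewrite /normal subsetIr normsI ?normG // (subset_trans sHG (normal_norm nsKG)).
Qed.

Lemma nilpotent_p_nilpotent G : nilpotent G -> p_nilpotent p G.
Proof. by move=> nilG; apply: nilpotent_pcore_Hall. Qed.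

Lemma p_nilpotent_index G H :
  H <| G -> p.-nat #|G : H| -> p_nilpotent p H -> p_nilpotent p G.
Proof.
move=> nsHG pGH /and3P[sKH p'K pHK].
apply: (@normal_complement_p_nilpotent _ 'O_p^'(H)%G).
  rewrite /pHall p'K (subset_trans sKH (normal_sub nsHG)) /=.
  by rewrite -(Lagrange_index (normal_sub nsHG) sKH) pnatM (eq_pnat _ (negnK _)) pGH.
exact: gFnormal_trans.
Qed.

(** Induction on |P| - |D| with D = P :&: Q. Sylow subgroups S and T of the [p]-nilpotent group
    N_G(D), chosen above N_P(D) and N_Q(D), are conjugate by an element of its [p']-core, which
    centralises D. A Sylow subgroup of [G] above S meets [P] in more than D, its conjugate above T
    meets [Q] in more than D, and induction links [P] to [Q] through these two. *)
Lemma Sylow_conj_cent_setI G P Q :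
    (forall X, X \subset G -> p.-group X -> X :!=: 1 -> p_nilpotent p 'N_G(X)) ->
    p.-Sylow(G) P -> p.-Sylow(G) Q ->
  exists2 c, c \in 'C_G(P :&: Q) & Q :=: P :^ c.
Proof.
move=> nilN; have [n] := ubnP (#|P| - #|P :&: Q|).
elim: n P Q => // n IHn P Q /ltnSE-le_n sylP sylQ.
have [sPG pP _] := and3P sylP; have [sQG pQ _] := and3P sylQ.
have [D1|ntD] := eqsVneq (P :&: Q) 1.
  have [c Gc defQ] := Sylow_trans sylP sylQ; exists c => //.
  by rewrite D1 cent1T setIT.
have [sPQ|nsPQ] := boolP (P \subset Q).
  exists 1; first by rewrite group1.
  by apply/eqP; rewrite conjsg1 eq_sym eqEcard sPQ (card_Hall sylP) (card_Hall sylQ) leqnn.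
set D := P :&: Q in ntD le_n *; pose N := 'N_G(D).
have sDP : D \subset P by apply: subsetIl.
have sDQ : D \subset Q by apply: subsetIr.
have sDG : D \subset G := subset_trans sDP sPG.
have pD : p.-group D := pgroupS sDP pP.
have prDP : D \proper P by rewrite properE sDP subsetI subxx.
have prDQ : D \proper Q.
  rewrite properE sDQ; apply: contra nsPQ => sQD.
  have /eqP <- : Q :==: P; last by [].
  rewrite eqEcard (subset_trans sQD sDP) (card_Hall sylP) (card_Hall sylQ) leqnn //.
have nilND := nilN [group of D] sDG pD ntD.
have [S sylS sS] : {S : {group gT} | p.-Sylow(N) S & 'N_P(D) \subset S}.
  by apply: Sylow_superset; [rewrite setSI | rewrite (pgroupS _ pP) // subsetIl].
have [T sylT sT] : {T : {group gT} | p.-Sylow(N) T & 'N_Q(D) \subset T}.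
  by apply: Sylow_superset; [rewrite setSI | rewrite (pgroupS _ pQ) // subsetIl].
have [Ss sylSs sSs] : {U : {group gT} | p.-Sylow(G) U & S \subset U}.
  apply: Sylow_superset (pHall_pgroup sylS).
  by rewrite (subset_trans (pHall_sub sylS)) ?subsetIl.
have [x Nx defT] := Sylow_trans sylS sylT.
have [_ defN _ _] := sdprodP (sdprod_p'core_HallP sylS nilND).
have nsKN := pcore_normal p^' N.
have nKS: S \subset 'N('O_p^'(N)).
  by rewrite (subset_trans (pHall_sub sylS)) ?normal_norm.
rewrite /= -/N -(normC nKS) in defN.
(* The factor [s] normalises [S], so the conjugation may be done by [k] in the [p']-core. *)
have /mulsgP[s k Ss1 Kk def_x] : x \in S * 'O_p^'(N) by rewrite defN.
have defTk : T :=: S :^ k by rewrite defT def_x conjsgM (conjGid Ss1).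
have cDk : k \in 'C_G(D).
  have Nk : k \in N by apply: (subsetP (normal_sub nsKN)).
  rewrite inE (subsetP (subsetIl G 'N(D)) k Nk) /=.
  have : 'O_p^'(N) \subset 'C(D).
    apply/commG1P/trivgP.
    have <- : D :&: 'O_p^'(N) = 1.
      by rewrite coprime_TIg // (pnat_coprime pD (pcore_pgroup _ _)).
    rewrite subsetI commg_subr commg_subl (subset_trans (normal_sub nsKN)) ?subsetIr //=.
    by rewrite (subset_trans _ (normal_norm nsKN)) // subsetI sDG normG.
  by move/subsetP->.
have nilP := pgroup_nil pP; have nilQ := pgroup_nil pQ.
have lt1 : D \proper P :&: Ss.
  apply: proper_sub_trans (nilpotent_proper_norm nilP prDP) _.
  by rewrite subsetI subsetIl (subset_trans sS).
have [c1 Cc1 defSs] : exists2 c, c \in 'C_G(P :&: Ss) & Ss :=: P :^ c.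
  apply: IHn => //; apply: leq_trans le_n.
  by rewrite ltn_sub2l ?proper_card.
have lt2 : D \proper Ss :^ k :&: Q.
  apply: proper_sub_trans (nilpotent_proper_norm nilQ prDQ) _.
  rewrite subsetI subsetIl andbT (subset_trans sT) // defTk conjSg //.
have Gk : k \in G by case/setIP: cDk.
have [c2 Cc2 defQ] : exists2 c, c \in 'C_G((Ss :^ k)%G :&: Q) & Q :=: (Ss :^ k)%G :^ c.
  apply: IHn => //; last by rewrite pHallJ.
  rewrite /= cardJg (card_Hall sylSs) -(card_Hall sylP); apply: leq_trans le_n.
  by rewrite ltn_sub2l ?proper_card.
exists (c1 * k * c2); last by rewrite !conjsgM -defSs.
rewrite !groupM //; first by rewrite (subsetP _ _ Cc1) // setIS ?centS ?proper_sub.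
by rewrite (subsetP _ _ Cc2) // setIS ?centS ?proper_sub.
Qed.

(** Since [x] lies in both P and P^(g^-1), some c centralising [x] carries the first to the second,
    and c g normalises [P]. The [p']-core of N_G(P) centralises [P], so only the [P]-part of c g
    acts on [x]. *)
Lemma local_p_nilpotent_fusion G P x g :
    (forall X, X \subset G -> p.-group X -> X :!=: 1 -> p_nilpotent p 'N_G(X)) ->
    p.-Sylow(G) P -> x \in P -> g \in G -> x ^ g \in P ->
  exists2 u, u \in P & x ^ g = x ^ u.
Proof.
move=> nilN sylP Px Gg Pxg; have [sPG pP _] := and3P sylP.
have [P1 | ntP] := eqsVneq P 1.
  exists 1; rewrite ?group1 //; move: Px; rewrite P1 => /set1P->.
  by rewrite !conj1g.
have sylPg : p.-Sylow(G) (P :^ g^-1)%G by rewrite pHallJ ?groupV.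
have [c /setIP[Gc Cc] defPg] := Sylow_conj_cent_setI nilN sylP sylPg.
have xc : x ^ c = x.
  apply/conjg_fixP/commgP/commute_sym; apply: (centP Cc).
  by rewrite inE Px /= mem_conjgV.
have Ncg : c * g \in 'N_G(P).
  rewrite inE groupM //=; apply/normP; rewrite conjsgM -defPg /=.
  by rewrite -conjsgM mulVg conjsg1.
have nilNP := nilN P sPG pP ntP.
have sylPN : p.-Sylow('N_G(P)) P.
  by apply: pHall_subl sylP; rewrite ?subsetIl // subsetI sPG normG.
have [_ defN _ tiKP] := sdprodP (sdprod_p'core_HallP sylPN nilNP).
have nsKN := pcore_normal p^' 'N_G(P).
have nKP : P \subset 'N('O_p^'('N_G(P))).
  by rewrite (subset_trans _ (normal_norm nsKN)) // subsetI sPG normG.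
rewrite -(normC nKP) in defN.
have /mulsgP[u k Pu Kk def_cg] : c * g \in P * 'O_p^'('N_G(P)) by rewrite defN.
exists u => //; rewrite -{1}xc -conjgM def_cg conjgM.
have : 'O_p^'('N_G(P)) \subset 'C(P).
  apply/commG1P/trivgP; rewrite -tiKP subsetI commg_subr commg_subl nKP /=.
  by rewrite (subset_trans (normal_sub nsKN)) ?subsetIr.
move/subsetP/(_ k Kk)=> Ck; apply/conjg_fixP/commgP/commute_sym.
by apply: (centP Ck); rewrite memJ_norm // (subsetP (normG P)).
Qed.

(** The subgroup is the kernel of the transfer from [G] to P / P'. Control of fusion makes the
    transfer of x in [P] equal to the image of x^|G : P|, and |G : P| is prime to [p]. *)
Lemma transfer_p_quotient G P :
    prime p -> p.-Sylow(G) P -> P :!=: 1 ->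
    (forall x g, x \in P -> g \in G -> x ^ g \in P ->
       exists2 u, u \in P & x ^ g = x ^ u) ->
  exists H : {group gT}, [/\ H <| G, p.-nat #|G : H| & H \proper G].
Proof.
move=> p_pr sylP ntP fusP; have [sPG pP p'GP] := and3P sylP.
have abA : abelian (coset P^`(1) @* P).
  exact: sub_der1_abelian.
have nPP : P \subset 'N(P^`(1)) by apply: der_norm.
pose al := [morphism of restrm nPP (coset P^`(1))].
have abl : abelian (al @* P) by rewrite morphim_restrm setIid.
pose V := transfer_morphism G abl.
have VE x : x \in P -> V x = fmod abl (al (x ^+ #|G : P|)).
  move=> Px; have Gx := subsetP sPG x Px.
  set n := fun y => #|<[x]> : P :* y|.
  pose X := transversal (rcosets P G :* <[x]>) G.
  have trX : is_transversal X (rcosets P G :* <[x]>) G.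
    exact: transversalP (rcosets_cycle_partition sPG Gx).
  rewrite /= (transfer_cycle_expansion sPG abl Gx trX) /=.
  rewrite -(sum_index_rcosets_cycle sPG Gx trX).
  have -> : forall m, fmod abl (al (x ^+ m)) = (fmod abl (al x) *+ m)%R.
    move=> m; rewrite /= !morphX //= ?fmodX //.
    exact: (mem_morphim al).
  rewrite -GRing.sumrMnr; apply: eq_bigr => y Xy.
  have Gy : y \in G by apply: (subsetP (transversal_sub trX)).
  rewrite /restrm /=.
  have Pxy : (x ^+ n y) ^ y^-1 \in P.
    have := mulg_exp_card_rcosets P x y.
    by rewrite mem_rcoset conjgE invgK mulgA.
  (* Each factor of the transfer formula is conjugate in [P] to a power of [x], hence equal to it
     modulo P'; the exponents add up to |G : P|. *)
  have [u Pu def_xy] := fusP _ _ (groupX (n y) Px) (groupVr Gy) Pxy.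
  rewrite -/(n y) def_xy.
  have -> : coset P^`(1) (x ^+ n y ^ u) = coset P^`(1) (x ^+ n y).
    rewrite morphJ ?groupX ?(subsetP nPP) //=.
    have cc : commute (coset P^`(1) (x ^+ n y)) (coset P^`(1) u).
      by apply: (centsP abA); rewrite mem_morphim ?groupX ?(subsetP nPP).
    by apply/conjg_fixP/commgP.
  rewrite morphX ?(subsetP nPP) //= fmodX //.
  exact: (mem_morphim al).
exists ('ker V)%G; split; first exact: ker_normal.
  have := card_isog (first_isog V); rewrite /= card_quotient ?ker_norm // => ->.
  have pA : p.-group (al @* P) by rewrite morphim_pgroup.
  rewrite (@pnat_dvd _ #|[set: fmod_of abl]|) ?cardSg ?subsetT //.
  rewrite cardsT; rewrite /pgroup in pA.
  by rewrite card_sub.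
(* Were the kernel all of [G], an [x] in [P] outside P' would have its |G : P|-th power in P', and
   by coprimality would lie in P' itself. *)
rewrite properEneq subsetIl andbT; apply/eqP=> kerG.
have ltP := sol_der1_proper (pgroup_sol pP) (subxx _) ntP.
case/properP: ltP => _ [x Px]; case/negP.
have coP : coprime #|P| #|G : P|.
  by rewrite (pnat_coprime pP).
rewrite -(expgK coP Px) groupX //.
have := VE x Px; rewrite (mker (_ : x \in 'ker V)); last first.
  by rewrite /= kerG (subsetP sPG).
have Pxn : x ^+ #|G : P| \in P by rewrite groupX.
move/esym=> /(congr1 (@fmval _ _ abl)); rewrite fmodK ?mem_morphim //.
by move/coset_idr => -> //; rewrite (subsetP nPP).
Qed.

(** The transfer kernel inherits the local hypothesis, and its normal [p]-complement is also one of
    [G] because the index is a power of [p]. *)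
Theorem Frobenius_p_nilpotent G :
    prime p ->
    (forall X, X \subset G -> p.-group X -> X :!=: 1 -> p_nilpotent p 'N_G(X)) ->
  p_nilpotent p G.
Proof.
move=> p_pr; have [n] := ubnP #|G|; elim: n G => // n IHn G /ltnSE-leGn nilN.
have [P sylP] := Sylow_exists p G.
have [P1 | ntP] := eqsVneq P 1.
  apply: (@normal_complement_p_nilpotent _ G); rewrite ?normal_refl //.
  rewrite /pHall subxx indexgg /= andbT -partG_eq1 -(card_Hall sylP) P1 cards1 //.
have fusP x g Px Gg := @local_p_nilpotent_fusion G P x g nilN sylP Px Gg.
have [H [nsHG pGH prHG]] := transfer_p_quotient p_pr sylP ntP fusP.
apply: p_nilpotent_index nsHG pGH _; apply: IHn.
  by apply: leq_trans leGn; apply: proper_card.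
move=> X sXH pX ntX; have sHG := proper_sub prHG.
by apply: p_nilpotentS (nilN X _ pX ntX); rewrite ?setSI // (subset_trans sXH).
Qed.

End PNilpotent.

Section PNilpotentQuotient.

Variables (gT : finGroupType) (p : nat).
Implicit Types G H : {group gT}.

Lemma pcore_sub_pseries2 (pi rho : nat_pred) G : 'O_pi(G) \subset 'O_{pi, rho}(G).
Proof. by rewrite -pseries1; apply: (pseries_sub_catl [:: pi] [:: rho]). Qed.

Lemma p_nilpotentJ G x : p_nilpotent p (G :^ x) = p_nilpotent p G.
Proof. by rewrite /p_nilpotent pcoreJ pHallJ2. Qed.

Lemma p_nilpotent_quotient G H :
  G \subset 'N(H) -> p_nilpotent p G -> p_nilpotent p (G / H).
Proof.
move=> nHG nilG; apply: (@normal_complement_p_nilpotent _ _ _ ('O_p^'(G) / H)%G).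
  by apply: quotient_pHall nilG; apply: subset_trans nHG; apply: pcore_sub.
by rewrite quotient_normal // pcore_normal.
Qed.

Lemma p_nilpotent_mod_p'group G H :
  H <| G -> p^'.-group H -> p_nilpotent p (G / H) -> p_nilpotent p G.
Proof.
move=> nsHG p'H; rewrite /p_nilpotent pquotient_pcore //.
have nsHK : H <| 'O_p^'(G).
  by rewrite (normalS _ (pcore_sub _ _) nsHG) // pcore_max.
by rewrite pquotient_pHall.
Qed.

End PNilpotentQuotient.

(** * The Thompson subgroup and quadratic action *)

Section ThompsonSubgroup.

Variable gT : finGroupType.
Implicit Types (P : {set gT}) (A H : {group gT}).

Definition max_abelian_order P : nat :=
  \max_(A : {group gT} | (A \subset P) && abelian A) #|A|.

Definition max_abelian P A : bool :=
  [&& A \subset P, abelian A & #|A| == max_abelian_order P].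

Definition thompsonJ P := <<\bigcup_(A : {group gT} | max_abelian P A) A>>.
Canonical thompsonJ_group P := Eval hnf in [group of thompsonJ P].

Lemma abelian_order_le P A :
  A \subset P -> abelian A -> #|A| <= max_abelian_order P.
Proof. by move=> sAP abA; apply: leq_bigmax_cond; rewrite sAP. Qed.

Lemma max_abelian_exists (P : {group gT}) : {A : {group gT} | max_abelian P A}.
Proof.
have P1: (1%G \subset P) && abelian (1%G : {group gT}) by rewrite sub1G abelian1.
exists [arg max_(A > 1%G | (A \subset P) && abelian A) #|A|].
rewrite /max_abelian /max_abelian_order (@bigmax_eq_arg _ 1%G
  (fun A : {group gT} => (A \subset P) && abelian A) (fun A => #|A|) P1).
by case: arg_maxnP => // A /andP[-> ->]; rewrite eqxx.
Qed.

Lemma max_abelian_sub_thompsonJ P A : max_abelian P A -> A \subset thompsonJ P.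
Proof. by move=> maxA; apply/sub_gen/bigcup_sup. Qed.

Lemma thompsonJ_sub (P : {group gT}) : thompsonJ P \subset P.
Proof. by rewrite gen_subG; apply/bigcupsP=> A /and3P[]. Qed.

Lemma max_abelian_orderJ P x : max_abelian_order (P :^ x) = max_abelian_order P.
Proof.
have le Q y : max_abelian_order (Q :^ y) <= max_abelian_order Q.
  apply/bigmax_leqP=> A /andP[sAQ abA].
  rewrite -(cardJg A y^-1); apply: (@abelian_order_le _ (A :^ y^-1)%G).
    by rewrite sub_conjgV.
  by rewrite abelianJ.
by apply/eqP; rewrite eqn_leq le -{1}(conjsgK x P) le.
Qed.

Lemma max_abelianJ P A x : max_abelian (P :^ x) (A :^ x)%G = max_abelian P A.
Proof. by rewrite /max_abelian conjSg abelianJ cardJg max_abelian_orderJ. Qed.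

Lemma thompsonJJ P x : thompsonJ (P :^ x) = thompsonJ P :^ x.
Proof.
have sub Q y : thompsonJ Q :^ y \subset thompsonJ (Q :^ y).
  rewrite -genJ gen_subG sub_conjg; apply/bigcupsP=> A maxA.
  by rewrite -sub_conjg max_abelian_sub_thompsonJ // max_abelianJ.
apply/eqP; rewrite eqEsubset sub andbT -sub_conjgV.
by apply: subset_trans (sub _ _) _; rewrite conjsgK.
Qed.

Lemma thompsonJ_norm P : 'N(P) \subset 'N(thompsonJ P).
Proof.
by apply/subsetP=> x /normP nPx; apply/normP; rewrite -thompsonJJ nPx.
Qed.

Lemma thompsonJ_neq1 (P : {group gT}) : P :!=: 1 -> thompsonJ P != 1.
Proof.
case/trivgPn=> x Px ntx; have [A maxA] := max_abelian_exists P.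
have sAJ := max_abelian_sub_thompsonJ maxA; case/and3P: maxA => _ _ /eqP oA.
have: 1 < #|A|.
  rewrite oA; apply: leq_trans (@abelian_order_le P <[x]>%G _ _).
  - by rewrite cardG_gt1 cycle_eq1.
  - by rewrite cycle_subG.
  exact: cycle_abelian.
rewrite cardG_gt1; apply: contraNneq => J1.
by rewrite -subG1 -J1.
Qed.

(** Serves with [H] the [p]-core of a group with Sylow subgroup [P]: once J(P) lies in the core it
    is characteristic in it, hence normal. *)
Lemma thompsonJ_eq (P H : {group gT}) :
  H \subset P -> thompsonJ P \subset H -> thompsonJ H = thompsonJ P.
Proof.
move=> sHP sJH.
have eq_ord : max_abelian_order H = max_abelian_order P.
  apply/eqP; rewrite eqn_leq; apply/andP; split.
    apply/bigmax_leqP=> A /andP[sAH abA].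
    by rewrite abelian_order_le // (subset_trans sAH).
  have [A maxA] := max_abelian_exists P.
  have sAJ := max_abelian_sub_thompsonJ maxA; case/and3P: maxA => _ abA /eqP <-.
  by rewrite abelian_order_le // (subset_trans sAJ).
congr <<_>>; apply: eq_bigl => A; apply/idP/idP => [/and3P[sA abA oA]|maxA].
  by rewrite /max_abelian (subset_trans sA) // abA -eq_ord.
have sAJ := max_abelian_sub_thompsonJ maxA; case/and3P: maxA => _ abA oA.
by rewrite /max_abelian (subset_trans sAJ) // abA eq_ord.
Qed.

End ThompsonSubgroup.

(** In additive notation for the [X]-module [V], the premise is u(a - b)(c - 1) = 0 and the
    conclusion u(c - 1)(a - b) = 0; the operators commute. *)
Lemma abelian_conj_cancel (gT : finGroupType) (V X : {group gT}) u a b c :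
    abelian V -> abelian X -> X \subset 'N(V) -> u \in V ->
    a \in X -> b \in X -> c \in X ->
    [~ u, a] * [~ u, b]^-1 \in 'C[c] -> [~ u, c] ^ a = [~ u, c] ^ b.
Proof.
move=> abV abX nVX Vu Xa Xb Xc.
have VJ z : z \in X -> u ^ z \in V by move=> Xz; rewrite memJ_norm ?(subsetP nVX).
have cV y z : y \in V -> z \in V -> y * z = z * y.
  by move=> Vy Vz; apply: (centsP abV).
have cX y z : y \in X -> z \in X -> y * z = z * y.
  by move=> Xy Xz; apply: (centsP abX).
have -> : [~ u, a] * [~ u, b]^-1 = u ^ a * (u ^ b)^-1.
  rewrite !commgEl invMg invgK -mulgA.
  have Vz := groupM (VJ a Xa) (groupM (groupVr (VJ b Xb)) Vu).
  by rewrite (cV _ _ (groupVr Vu) Vz) !mulgA mulgK.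
move/cent1P/commgP/conjg_fixP; rewrite conjMg conjVg -!conjgM => E.
have JE z : z \in X -> [~ u, c] ^ z = (u ^ z)^-1 * u ^ (z * c).
  by move=> Xz; rewrite commgEl conjMg conjVg -conjgM cX.
rewrite !JE //.
apply: (mulgI (u ^ a)); rewrite mulKVg.
have: u ^ (a * c) = u ^ a * (u ^ b)^-1 * u ^ (b * c) by rewrite -E mulgKV.
by rewrite -!mulgA.
Qed.

(** * Replacement for abelian groups acting on an abelian group *)

Section Offender.

Variables (gT : finGroupType) (p : nat) (V A : {group gT}).
Hypotheses (pV : p.-group V) (pA : p.-group A).
Hypotheses (abV : abelian V) (abA : abelian A) (nVA : A \subset 'N(V)).

(** The Chermak-Delgado measure of [X] acting on [V]. *)
Let j (X : {group gT}) := (#|X| * #|'C_V(X)|)%N.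

(** The map Yx |-> [u, x] C_V(X), with Y = C_X(M) and x the chosen representative, is injective by
    [abelian_conj_cancel], so |X : Y| is at most |M C_V(X) : C_V(X)|. Consequently passing from X to
    Y does not lower [j]. *)
Lemma offender_step (X : {group gT}) u (M := [~: [set u], X]) :
    X \subset A -> u \in V ->
  [/\ M \subset V, M <*> 'C_V(X) \subset 'C_V('C_X(M))
    & j X <= #|'C_X(M)| * #|M <*> 'C_V(X)|].
Proof.
move=> sXA Vu; have nVX := subset_trans sXA nVA; have abX := abelianS sXA abA.
have sMV : M \subset V.
  rewrite (subset_trans (commSg _ (_ : _ \subset V))) ?sub1set //.
  by rewrite commg_subl.
have sW : M <*> 'C_V(X) \subset 'C_V('C_X(M)).
  rewrite join_subG !subsetI sMV subsetIl /= centsC subsetIr /=.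
  by rewrite (subset_trans (subsetIr _ _)) // centS ?subsetIl.
split=> //; set W := M <*> 'C_V(X); set C := 'C_V(X); set Y := 'C_X(M).
have sWV : W \subset V by apply: subset_trans sW (subsetIl _ _).
have sCW : C \subset W by apply: joing_subr.
have nCW : W \subset 'N(C).
  by rewrite (subset_trans sWV) // (subset_trans abV) // cents_norm // centS ?subsetIl.
have sYX : Y \subset X by apply: subsetIl.
rewrite /j -/C -(Lagrange sYX) -mulnA leq_pmul2l ?cardG_gt0 //.
rewrite -(Lagrange sCW) mulnC leq_pmul2l ?cardG_gt0 //.
pose f B := coset C [~ u, repr B].
have inj_f : {in rcosets Y X &, injective f}.
  move=> _ _ /rcosetsP[x Xx ->] /rcosetsP[y Xy ->]; rewrite /f.
  have /rcosetP[x1 Yx1 ->] := mem_repr_rcoset [group of Y] x.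
  have /rcosetP[y1 Yy1 ->] := mem_repr_rcoset [group of Y] y.
  set a := x1 * x; set b := y1 * y.
  have Xa : a \in X by rewrite groupM // (subsetP sYX).
  have Xb : b \in X by rewrite groupM // (subsetP sYX).
  have Wa : [~ u, a] \in W by rewrite (subsetP (joing_subl _ _)) // mem_commg ?set11.
  have Wb : [~ u, b] \in W by rewrite (subsetP (joing_subl _ _)) // mem_commg ?set11.
  move=> eq_ab.
  have Cab : [~ u, a] * [~ u, b]^-1 \in C.
    apply: coset_idr; first by rewrite groupM ?groupV ?(subsetP nCW).
    by rewrite morphM ?groupV ?(subsetP nCW) //= eq_ab morphV ?(subsetP nCW) //= mulgV.
  have Yab : a * b^-1 \in Y.
    rewrite inE groupM ?groupV //= cent_gen; apply/centP=> _ /imset2P[_ c /set1P-> Xc ->].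
    apply/esym/commgP/conjg_fixP.
    rewrite conjgM (@abelian_conj_cancel _ V X u a b c) ?conjgK //.
    by apply/cent1P/esym; case/setIP: Cab => _ /centP/(_ c Xc).
  apply/rcoset_eqP; rewrite mem_rcoset.
  rewrite /a /b invMg !mulgA in Yab.
  have : x1^-1 * (x1 * x * y^-1 * y1^-1) * y1 \in Y.
    exact: groupM (groupM (groupVr Yx1) Yab) Yy1.
  by rewrite !mulgA mulVg mul1g mulgKV.
apply: (@leq_trans #|f @: rcosets Y X|); first by rewrite (card_in_imset inj_f).
rewrite -[X in _ <= X]card_quotient //.
apply/subset_leq_card/subsetP=> _ /imsetP[B /rcosetsP[x Xx ->] ->].
have Xr : repr (Y :* x) \in X.
  have /rcosetP[y Yy ->] := mem_repr_rcoset [group of Y] x.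
  by rewrite groupM // (subsetP sYX).
have Mr : [~ u, repr (Y :* x)] \in W.
  by rewrite (subsetP (joing_subl _ _)) // mem_commg ?set11.
by rewrite mem_quotient.
Qed.

(* Timmesfeld replacement: a subgroup X maximising |X||C_V(X)|, and minimal
   subject to this and to not centralising V, acts quadratically. *)
Lemma quadratic_offender :
    ~~ (A \subset 'C(V)) -> #|'C_A(V)| * #|V| <= #|A| * #|'C_V(A)| ->
  exists X : {group gT}, [/\ X \subset A, ~~ (X \subset 'C(V)) & [~: V, X, X] = 1].
Proof.
move=> ncVA offA.
pose m := \max_(X : {group gT} | X \subset A) j X.
have le_m (X : {group gT}) : X \subset A -> j X <= m by move=> sXA; apply: leq_bigmax_cond.
pose good (X : {group gT}) := [&& X \subset A, ~~ (X \subset 'C(V)) & j X == m].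
(* A maximiser X0 of [j] serves unless it centralises [V]; in that case j X0 <= |C_A(V)||V| <= j A
   by [offA], so [A] is itself a maximiser. *)
have [X0 goodX0] : exists X, good X.
  pose X0 := [arg max_(X > A | X \subset A) j X]%G.
  have [sX0 jX0] : X0 \subset A /\ j X0 = m.
    rewrite /m (bigmax_eq_arg A) //; split=> //.
    by rewrite /X0; case: arg_maxnP.
  have [cX0|ncX0] := boolP (X0 \subset 'C(V)); last first.
    by exists X0; rewrite /good sX0 ncX0 jX0 eqxx.
  exists A; rewrite /good subxx ncVA eqn_leq le_m //= -jX0.
  apply: leq_trans offA; apply: leq_mul; apply: subset_leq_card; last exact: subsetIl.
  by rewrite subsetI sX0.
have [X /mingroupP[/and3P[sXA ncX /eqP jX] minX]] :=
  @ex_mingroup _ good (ex_intro _ X0 goodX0).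
exists X; split=> //; apply/commG1P; rewrite gen_subG.
have nVX := subset_trans sXA nVA.
apply/subsetP=> _ /imset2P[u a Vu Xa ->].
have [] := offender_step sXA Vu.
set M := [~: [set u], X] => sMV sW le_j; set Y := 'C_X(M)%G.
have sYX : Y \subset X by apply: subsetIl.
have sYA := subset_trans sYX sXA.
have le2 : #|'C_X(M)| * #|M <*> 'C_V(X)| <= j Y.
  by rewrite leq_mul2l (subset_leq_card sW) orbT.
have jY : j Y = m by apply/eqP; rewrite eqn_leq le_m //= -jX (leq_trans le_j).
(* [Y] also maximises [j]. If it does not centralise [V], minimality of [X] gives [Y = X], so [X]
   centralises [u, X]. *)
have [cY | ncY] := boolP (Y \subset 'C(V)); last first.
  have defY : Y :=: X by apply: minX; rewrite // /good sYA ncY jY eqxx.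
  have : X \subset 'C(M) by rewrite -defY; apply: subsetIr.
  by rewrite centsC => /subsetP-> //; rewrite mem_commg ?set11.
(* In the other case |V| <= |M C_V(X)|. Then [V, X] = [M, X] lies in [V, X, X], which nilpotency of
   [V <*> A] forbids unless [V, X] = 1. *)
have defW : M <*> 'C_V(X) = V.
  apply/eqP; rewrite eqEcard (subset_trans sW) ?subsetIl //=.
  rewrite -(leq_pmul2l (cardG_gt0 Y)).
  have -> : #|V| = #|'C_V(Y)| by rewrite (setIidPl _) // centsC.
  by rewrite -[X in X <= _]/(j Y) jY -jX.
case/negP: ncX; rewrite centsC; apply/commG1P/eqP.
apply: contraT => ntVX.
have nilVA : nilpotent (V <*> A).
  by apply: (@pgroup_nil _ p); rewrite /= norm_joinEr // pgroupM pV.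
have sVX : [~: V, X] \subset V by rewrite commg_subl.
have nVXX : X \subset 'N([~: V, X]) by rewrite commg_normr.
have : [~: V, X, X] \proper [~: V, X].
  apply: (nil_comm_properl nilVA) => //=; first by rewrite (subset_trans sVX) ?joing_subl.
  by rewrite subsetI nVXX andbT (subset_trans sXA) ?joing_subr.
rewrite properE => /andP[_] /negP[].
rewrite -{1}defW.
have nMX : X \subset 'N(M) by rewrite commg_normr.
rewrite gen_subG; apply/subsetP=> _ /imset2P[w x Ww Xx ->].
have sMVX : M \subset [~: V, X] by rewrite commSg ?sub1set.
rewrite cent_joinEr in Ww; last first.
  by rewrite (subset_trans (subsetIl _ _)) // (subset_trans abV) ?centS.
case/mulsgP: Ww => y c My /setIP[Vc /centP cc] ->.
have -> : [~ y * c, x] = [~ y, x].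
  rewrite commMgJ; have /commgP/eqP -> : commute c x by apply: cc.
  rewrite mulg1; apply/conjg_fixP/commgP; apply: (centsP abV) => //.
  apply: (subsetP sVX); rewrite mem_commg // (subsetP sMV) //.
by rewrite mem_commg ?(subsetP sMVX).
Qed.

End Offender.

Section QuadraticAction.
Local Open Scope ring_scope.

(* With E = yN - Ny, the conjugates of y by 1 +/- N are y +/- E - NyN; if both
   commute with y then so does E, whence y^m N - N y^m = m y^(m-1) E. *)
Lemma quadratic_commute (R : nzRingType) (N y : R) m :
    N * N = 0 -> y ^+ m = 1 ->
    (forall z : R, z *+ 2 = 0 -> z = 0) -> (forall z : R, z *+ m = 0 -> z = 0) ->
    GRing.comm y ((1 - N) * y * (1 + N)) -> GRing.comm y ((1 + N) * y * (1 - N)) ->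
  GRing.comm y N.
Proof.
move=> N2 ym reg2 regm; pose E := y * N - N * y; pose F := N * y * N.
have -> : (1 - N) * y * (1 + N) = y + E - F.
  by rewrite mulrDr mulr1 mulrBl mul1r mulrBl -/F /E !addrA (addrAC y).
have -> : (1 + N) * y * (1 - N) = y - E - F.
  by rewrite mulrBr mulr1 mulrDl mul1r mulrDl -/F /E opprB opprD !addrA.
move=> c1 c2.
have cyE : GRing.comm y E.
  have := commrB c1 c2.
  have -> : y + E - F - (y - E - F) = E *+ 2.
    rewrite (addrAC y E) (addrAC y (- E)) opprD addrACA subrr add0r opprK.
    by rewrite mulr2n.
  rewrite /GRing.comm mulrnAr mulrnAl => /eqP; rewrite -subr_eq0 -mulrnBl.
  by move/eqP/reg2/eqP; rewrite subr_eq0 => /eqP.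
have yN k : y ^+ k.+1 * N - N * y ^+ k.+1 = (y ^+ k * E) *+ k.+1.
  elim: k => [|k IHk]; first by rewrite !expr1 expr0 mul1r mulr1n.
  have -> : y ^+ k.+2 * N - N * y ^+ k.+2 =
     y * (y ^+ k.+1 * N - N * y ^+ k.+1) + E * y ^+ k.+1.
    by rewrite mulrBr mulrBl [y ^+ k.+2]exprS !mulrA addrA subrK.
  rewrite IHk mulrnAr mulrA -exprS [RHS]mulrSr; congr (_ + _).
  exact/commrX/commr_sym.
(* For [m = 0] the hypothesis [regm] makes every element zero. *)
case: m => [|m] in ym regm *.
  have z0 (z : R) : z = 0 by apply: regm; rewrite mulr0n.
  by rewrite /GRing.comm (z0 (y * N)) (z0 (N * y)).
have := yN m; rewrite ym mul1r mulr1 subrr => /esym/regm yE.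
have E0 : E = 0 by rewrite -[E]mul1r -ym exprS -mulrA yE mulr0.
by apply/eqP; rewrite -subr_eq0 -/E E0.
Qed.
End QuadraticAction.

(** [quadratic_commute] is applied in the matrix ring of [V] over F_p, with N = x - 1. Conjugates of
    y under [X] commute with y because K' acts trivially; 2 and [m] are invertible because [p] is
    odd and does not divide [m]. *)
Lemma quadratic_centralises (gT : finGroupType) (p m : nat) (V K X : {group gT}) x y :
    odd p -> prime p -> p.-abelem V -> ~~ (p %| m) ->
    K \subset 'N(V) -> X \subset 'N(V) -> X \subset 'N(K) ->
    K^`(1) \subset 'C(V) -> {in K, forall z, z ^+ m \in 'C(V)} ->
    [~: V, X, X] = 1 -> x \in X -> y \in K ->
  [~ x, y] \in 'C(V).
Proof.
move=> odd_p p_pr abelV p'm nVK nVX nKX cVK' cVKm quad Xx Ky.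
have [V1 | ntV] := eqsVneq V 1; first by rewrite V1 cent1T inE.
have nVG : K <*> X \subset 'N(V) by rewrite join_subG nVK.
pose rG := abelem_repr abelV ntV nVG.
have Gx : x \in K <*> X by rewrite (subsetP (joing_subr _ _)).
have Gy z : z \in K -> z \in K <*> X by apply/subsetP/joing_subl.
have Ky2 z : z \in X -> y ^ z \in K by move=> Xz; rewrite memJ_norm ?(subsetP nKX).
have kerP z : z \in K <*> X -> (rG z = 1%:M)%R <-> z \in 'C(V).
  move=> Gz; have := congr1 (fun A : {set gT} => z \in A) (rker_abelem abelV ntV nVG).
  rewrite !inE Gz /= mul1mx => <-; split=> [->|/eqP //]; exact: eqxx.
pose N : 'M['F_p]_('dim V) := (rG x - 1)%R.
(* Multiplying a row vector by [N] is taking the commutator with [x]. *)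
have N2 : (N * N = 0)%R.
  apply/row_matrixP=> i; rewrite row0 rowE -mulmxE mulmxA.
  set u := delta_mx _ _.
  have NE (w : 'rV_('dim V)) : rVabelem abelV ntV (w *m N) = [~ rVabelem abelV ntV w, x].
    rewrite /N mulmxBr rVabelemD rVabelemN -idmxE mulmx1 rVabelemJ //.
    set v := rVabelem _ _ _; rewrite commgEl.
    apply: (centsP (abelem_abelian abelV)); rewrite ?groupV ?memJ_norm ?mem_rVabelem //.
    by rewrite (subsetP nVX).
  apply: (@rVabelem_inj _ _ _ abelV ntV); rewrite !NE rVabelem0.
  apply/set1P; rewrite -[[set 1]]quad mem_commg // mem_commg // mem_rVabelem //.
have rx : (rG x = 1 + N)%R by rewrite /N addrC subrK.
have rxV : (rG (x^-1)%g = 1 - N)%R.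
  have : (rG (x^-1)%g *m rG x = 1%:M)%R by rewrite -repr_mxM ?groupV // mulVg repr_mx1.
  rewrite rx mulmxE idmxE => h.
  have := congr1 (fun z => z * (1 - N))%R h.
  by rewrite mul1r -mulrA mulrBr mulr1 mulrDl mul1r N2 addr0 addrK mulr1.
have comm z : z \in X -> GRing.comm (rG y) (rG (y ^ z)).
  move=> Xz; rewrite /GRing.comm -!mulmxE -!repr_mxM ?Gy ?Ky2 //.
  have Kyz := Ky2 z Xz.
  have /kerP : [~ y, y ^ z] \in 'C(V) by rewrite (subsetP cVK') // mem_commg.
  rewrite Gy ?groupR // => /(_ isT) h.
  have G1 : y ^ z * y \in K <*> X by exact: Gy (groupM Kyz Ky).
  have G2 : [~ y, y ^ z] \in K <*> X by exact: Gy (groupR Ky Kyz).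
  by rewrite commgC (repr_mxM rG G1 G2) h mulmx1.
have regp (k : nat) (z : 'M['F_p]_('dim V)) : ~~ (p %| k) -> (z *+ k = 0 -> z = 0)%R.
  move=> p'k; rewrite -scaler_nat => /eqP; rewrite scaler_eq0.
  by rewrite -(dvdn_pcharf (pchar_Fp p_pr)) (negPf p'k) => /eqP.
have Gyy := Gy y Ky.
have rJ z : z \in K <*> X -> rG (y ^ z) = (rG (z^-1)%g * rG y * rG z)%R.
  by move=> Gz; rewrite conjgE !repr_mxM ?groupM ?groupV // mulmxA.
have cyN : GRing.comm (rG y) N.
  apply: (@quadratic_commute _ N (rG y) m) => //.
  - have /kerP h : y ^+ m \in 'C(V) by apply: cVKm.
    rewrite -idmxE -h ?groupX ?Gy //.
    by elim: (m) => [|k IHk]; rewrite ?expg0 ?expr0 ?repr_mx1 // expgS exprS repr_mxM ?groupX ?Gy // IHk.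
  - by move=> z; apply: regp; rewrite dvdn_prime2 //; apply: contraTneq odd_p => ->.
  - by move=> z; apply: regp.
  - by have := comm x Xx; rewrite rJ // rx rxV.
  - by have := comm x^-1 (groupVr Xx); rewrite rJ ?groupV // invgK rx rxV.
apply/(kerP _ (groupR Gx Gyy)).
have cxy : (rG x *m rG y = rG y *m rG x)%R.
  by rewrite rx !mulmxE mulrDl mulrDr mul1r mulr1 cyN.
have -> : [~ x, y] = (y * x)^-1 * (x * y) by rewrite invMg -mulgA.
have Gxy := groupM Gx Gyy; have Gyx := groupM Gyy Gx.
rewrite repr_mxM ?groupV // (repr_mxM rG Gx Gyy) cxy -(repr_mxM rG Gyy Gx).
by rewrite -repr_mxM ?groupV // mulVg repr_mx1.
Qed.

(** * Thompson's normal p-complement theorem *)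

Section ThompsonConfiguration.

Variables (gT : finGroupType) (p : nat) (G P : {group gT}).
Hypotheses (p_pr : prime p) (odd_p : odd p) (sylP : p.-Sylow(G) P).
Hypothesis nilG_O : p_nilpotent p (G / 'O_p(G)).
Hypothesis IH : forall H : {group gT},
  P \subset H -> H \proper G -> p_nilpotent p H.
Hypothesis nilJ : p_nilpotent p 'N_G(thompsonJ P).
Hypothesis nilZ : p_nilpotent p 'C_G('Ohm_1('Z(P))).
Hypothesis not_nilG : ~~ p_nilpotent p G.

(** Here K / O is the normal [p]-complement of G / O, and [M] replaces [O] so that one need not
    factor out [L] first. The aim is that G / M acts faithfully on the elementary abelian group
    [V]. *)
Local Notation O := 'O_p(G).
Local Notation L := 'O_p^'(G).
Local Notation M := (L <*> O).
Local Notation K := 'O_{p, p^'}(G).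
Local Notation V := 'Ohm_1('Z(O)).

Let sPG : P \subset G := pHall_sub sylP.
Let pP : p.-group P := pHall_pgroup sylP.
Let pO : p.-group O := pcore_pgroup p G.
Let p'L : p^'.-group L := pcore_pgroup p^' G.
Let nsOG : O <| G := pcore_normal p G.
Let nsLG : L <| G := pcore_normal p^' G.
Let nsMG : M <| G.
Proof. exact: normalY. Qed.
Let nsKG : K <| G := pseries_normal _ G.
Let sOP : O \subset P := pcore_sub_Hall sylP.

Let defM : L * O = M.
Proof. by rewrite norm_joinEr // (subset_trans (pcore_sub p G)) // normal_norm. Qed.

Let hallO : p.-Hall(M) O.
Proof. by have [] := coprime_mulGp_Hall defM p'L pO. Qed.

Let cLO : L \subset 'C(O).
Proof.
apply/commG1P/trivgP; rewrite -(TI_pcoreC p G G) setIC subsetI commg_subr commg_subl.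
by rewrite (subset_trans (pcore_sub p G) (normal_norm nsLG))
  (subset_trans (pcore_sub p^' G) (normal_norm nsOG)).
Qed.

(** With W = O_{p',p}(G) = L (P :&: W), the Frattini argument gives G = L N_G(P :&: W). If this
    normaliser were proper it would be [p]-nilpotent by [IH], and so would G / L and [G]; hence P
    :&: W is normal and lies in [O]. *)
Let pseries_sub_M : 'O_{p^', p}(G) \subset M.
Proof.
set W := 'O_{p^', p}(G); have nsWG : W <| G by apply: pseries_normal.
have sylP0 : p.-Sylow(W) (P :&: W).
  by have := Sylow_setI_normal nsWG sylP; rewrite setIC.
have sLW : L \subset W by exact: pcore_sub_pseries2.
have defW : L * (P :&: W) = W.
  apply/eqP; rewrite eqEcard mul_subG ?subsetIr //=.
  have pWL : p.-group (W / L) by rewrite /W quotient_pseries2 pcore_pgroup.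
  have tiLP : L :&: (P :&: W) = 1.
    by apply: coprime_TIg; rewrite coprime_sym (pnat_coprime (pgroupS (subsetIl _ _) pP)).
  rewrite (TI_cardMg tiLP) (card_Hall sylP0) -(Lagrange sLW) leq_pmul2l //.
  rewrite partnM // part_p'nat // mul1n part_pnat_id // -card_quotient //.
  exact: subset_trans (pseries_sub _ _) (normal_norm nsLG).
have nP0 : P \subset 'N(P :&: W).
  by rewrite normsI ?normG // (subset_trans sPG) // normal_norm.
have defG : W * 'N_G(P :&: W) = G := Frattini_arg nsWG sylP0.
suffices defN : 'N_G(P :&: W) = G.
  rewrite -defW -defM mulgS // pcore_max ?(pgroupS (subsetIl _ _) pP) //.
  by rewrite /normal (subset_trans (subsetIl _ _) sPG) -{1}defN subsetIr.
apply/eqP; apply: contraR not_nilG => neN.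
have nilN : p_nilpotent p 'N_G(P :&: W).
  by apply: IH; [rewrite subsetI sPG | rewrite properEneq neN subsetIl].
apply: (p_nilpotent_mod_p'group nsLG p'L).
have sP0N : P :&: W \subset 'N_G(P :&: W).
  by rewrite subsetI normG (subset_trans (subsetIl _ _) sPG).
have <- : 'N_G(P :&: W) / L = G / L.
  have defG2 : L * (P :&: W) * 'N_G(P :&: W) = G by rewrite defW.
  by rewrite -mulgA (mulSGid sP0N) in defG2; rewrite -quotientMidl defG2.
by apply: p_nilpotent_quotient nilN; rewrite subIset // normal_norm.
Qed.

(** In other words O_p(G / M) = 1: since M / L is a [p]-group, X M / L is a normal [p]-subgroup of G
    / L, and [pseries_sub_M] applies. *)
Let sub_M (X : {group gT}) : X <| G -> p.-group (X / M) -> X \subset M.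
Proof.
move=> nsXG pXM; have [sXG nXG] := andP nsXG; have nMX := subset_trans sXG (normal_norm nsMG).
apply: subset_trans pseries_sub_M.
have sLM : L \subset M by apply: joing_subl.
have nLG := normal_norm nsLG.
have nsXMG : X <*> M <| G by apply: normalY.
have sXMG := normal_sub nsXMG.
have: (X <*> M) / L \subset 'O_p(G / L).
  apply: pcore_max; last by rewrite quotient_normal.
  rewrite /pgroup card_quotient ?(subset_trans sXMG) //.
  rewrite -(@Lagrange_index _ _ M) ?joing_subr // pnatM; apply/andP; split.
    rewrite -card_quotient; last by rewrite join_subG nMX normG.
    by rewrite quotientYidr.
  rewrite -card_quotient ?(subset_trans (normal_sub nsMG)) //=.
  rewrite quotientYidl; first exact: quotient_pgroup.
  exact: subset_trans (pcore_sub p G) nLG.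
rewrite -quotient_pseries2 => /(subset_trans (quotientS _ (joing_subl X M))).
rewrite quotientSGK //; first exact: subset_trans nLG.
exact: pcore_sub_pseries2.
Qed.

Let sOK : O \subset K.
Proof. exact: pcore_sub_pseries2. Qed.

Let p'KO : p^'.-group (K / O).
Proof. by rewrite quotient_pseries2 pcore_pgroup. Qed.

Let pGK : p.-nat #|G : K|.
Proof.
have := nilG_O; rewrite /p_nilpotent -quotient_pseries2 => /and3P[_ _].
rewrite (index_quotient_eq (subset_trans (subsetIr G _) sOK) (normal_sub nsKG) (normal_norm nsOG)).
by rewrite pnatNK.
Qed.

Let sMK : M \subset K.
Proof.
rewrite join_subG sOK andbT.
have : L / O \subset K / O.
  rewrite quotient_pseries2 pcore_max ?quotient_pgroup //.
  by rewrite quotient_normal.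
by rewrite quotientSGK // (subset_trans (pcore_sub _ _)) // normal_norm.
Qed.

(** As G / K is a [p]-group, [sub_M] reduces this to D = C_G(O) :&: K. The Sylow subgroup D :&: O is
    central in D, so its Schur-Zassenhaus complement is normal and falls into [L]. *)
Let cent_O_sub_M : 'C_G(O) \subset M.
Proof.
have nOG := normal_norm nsOG.
have nsCG : 'C_G(O) <| G by rewrite /normal subsetIl normsI ?normG // norms_cent.
have nKG := normal_norm nsKG.
apply: sub_M => //.
have nMC : 'C_G(O) \subset 'N(M) by rewrite (subset_trans (subsetIl _ _)) ?normal_norm.
rewrite /pgroup card_quotient //.
suffices sCKM : 'C_G(O) :&: K \subset M.
  apply: (@pnat_dvd _ #|'C_G(O) : K|).
    by rewrite -[X in _ %| X]indexgI indexgS.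
  rewrite -card_quotient ?subIset ?nKG // (pnat_dvd (cardSg (quotientS _ (subsetIl G _)))) //.
  by rewrite card_quotient.
pose D := ('C_G(O) :&: K)%G; rewrite -[_ :&: K]/(gval D).
have nsDG : D <| G by exact: normalI.
have cDO : D \subset 'C(O) by rewrite subIset // subsetIr.
have nsDO : D :&: O <| D.
  by rewrite /normal subsetIl normsI ?normG // cents_norm.
have hallDO : p.-Hall(D) (D :&: O).
  rewrite /pHall subsetIl (pgroupS (subsetIr _ _) pO) /= indexgI.
  rewrite -card_quotient ?cents_norm //.
  by apply: pnat_dvd p'KO; rewrite cardSg ?quotientS ?subsetIr.
have /splitsP[F complF] := SchurZassenhaus_split (pHall_Hall hallDO) nsDO.
have hallF : p^'.-Hall(D) F by rewrite -(compl_pHall _ hallDO).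
have [_ defD] := complP complF.
have sFD := pHall_sub hallF.
have nsFD : F <| D.
  rewrite /normal sFD -defD mulG_subG normG andbT.
  by rewrite cents_norm // centsC (subset_trans sFD) // (subset_trans cDO) // centS ?subsetIr.
have sFL : F \subset L.
  by rewrite -(normal_Hall_pcore hallF nsFD) pcore_max ?pcore_pgroup // gFnormal_trans.
by rewrite -defD mul_subG ?(subset_trans (subsetIr _ _)) ?joing_subr ?(subset_trans sFL) ?joing_subl.
Qed.

Let nVG : G \subset 'N(V).
Proof. by rewrite normal_norm // !gFnormal_trans. Qed.

Let sVO : V \subset O.
Proof. by rewrite (subset_trans (Ohm_sub _ _)) ?subsetIl. Qed.

(** Z(P) centralises [O], so it lies in [M] and then in [O], whence Ohm_1(Z(P)) is in [V]. By [nilZ]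
    the group C_G(V) is [p]-nilpotent; its [p]-complement lies in [L], and [sub_M] disposes of the
    rest. *)
Let cent_V : 'C_G(V) = M.
Proof.
apply/eqP; rewrite eqEsubset; apply/andP; split; last first.
  rewrite subsetI (normal_sub nsMG) join_subG (subset_trans cLO) ?centS //=.
  by rewrite centsC (subset_trans (Ohm_sub _ _)) // subsetIr.
have sZO : 'Z(P) \subset O.
  have sZM : 'Z(P) \subset M.
    apply: subset_trans cent_O_sub_M; rewrite subsetI (subset_trans (center_sub _)) //.
    by rewrite subIset // centS ?orbT.
  rewrite (sub_normal_Hall hallO) ?(pgroupS (center_sub _) pP) //.
  by rewrite (normalS _ (normal_sub nsMG)) ?joing_subr.
have sZV : 'Ohm_1('Z(P)) \subset V.
  by apply: OhmS; rewrite subsetI sZO subIset // centS ?orbT.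
have nilC : p_nilpotent p 'C_G(V).
  by apply: p_nilpotentS nilZ; rewrite setIS // centS.
have nsCG : 'C_G(V) <| G by rewrite /normal subsetIl normsI ?normG // norms_cent.
apply: sub_M => //.
rewrite /pgroup card_quotient ?(subset_trans (subsetIl _ _)) ?normal_norm //.
have sL : 'O_p^'('C_G(V)) \subset M.
  rewrite (subset_trans _ (joing_subl _ _)) // pcore_max ?pcore_pgroup //.
  exact: gFnormal_trans.
apply: pnat_dvd (indexgS _ sL) _.
by have /and3P[_ _] := nilC; rewrite pnatNK.
Qed.

(** Let A0 be the centre of a [P]-invariant Sylow subgroup of K / M. If the preimage G1 of A0 (P /
    M) were proper, it would be [p]-nilpotent with a complement centralising [O], hence inside [M],
    making the [p']-group A0 trivial. So G1 = G and K / M = A0. *)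
Let abelian_KM : abelian (K / M).
Proof.
have nMG := normal_norm nsMG.
have p'KM : p^'.-group (K / M).
  rewrite /pgroup card_quotient ?(subset_trans (normal_sub nsKG)) //.
  apply: (@pnat_dvd _ #|K : O|); first by rewrite indexgS ?joing_subr.
  by rewrite -card_quotient // (subset_trans (normal_sub nsKG)) // normal_norm.
have [KM1 | [r r_pr rK]] := trivgVpdiv (K / M)%G; first by rewrite /= KM1 abelian1.
have coKP : coprime #|K / M| #|P / M|.
  by rewrite coprime_sym (pnat_coprime (quotient_pgroup _ pP)).
have nKP : P / M \subset 'N(K / M).
  by rewrite quotient_norms // (subset_trans sPG) // normal_norm.
have [R sylR nRP] := sol_coprime_Sylow_exists r (pgroup_sol (quotient_pgroup _ pP)) nKP coKP.
pose A0 := 'Z(R)%G.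
have ntA0 : A0 :!=: 1.
  rewrite /= (center_nil_eq1 (pgroup_nil (pHall_pgroup sylR))).
  rewrite -cardG_gt1 (card_Hall sylR) p_part_gt1 mem_primes r_pr cardG_gt0 //.
have nA0P : P / M \subset 'N(A0) by apply: gFnorm_trans.
have sA0K : A0 \subset K / M by rewrite (subset_trans (center_sub _)) ?(pHall_sub sylR).
have p'A0 : p^'.-group A0 := pgroupS sA0K p'KM.
have sA0G : A0 <*> (P / M) \subset G / M.
  by rewrite join_subG (subset_trans sA0K) ?quotientS ?(normal_sub nsKG).
have [G1 [defG1 sMG1 sG1G]] : exists G1 : {group gT},
    [/\ A0 <*> (P / M) = G1 / M, M \subset G1 & G1 \subset G].
  have [G1 ? ? ?] := inv_quotientS nsMG sA0G; exists G1; split=> //.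
have sPG1 : P \subset G1.
  have : P / M \subset G1 / M by rewrite -defG1 joing_subr.
  by rewrite quotientSGK // (subset_trans sPG).
have [pr | npr] := boolP (G1 \proper G); last first.
  have defG : G1 :=: G by apply/eqP; rewrite eqEproper sG1G npr.
  have hallA0 : p^'.-Hall(G / M) A0.
    have defGM : A0 * (P / M) = G / M by rewrite -norm_joinEr // [LHS]defG1 defG.
    by have [] := coprime_mulGp_Hall defGM p'A0 (quotient_pgroup _ pP).
  have -> : K / M = A0.
    by apply: (sub_pHall hallA0); rewrite ?quotientS ?(normal_sub nsKG).
  exact: center_abelian.
have nilG1 := IH sPG1 pr.
have E1M : 'O_p^'(G1) \subset M.
  apply: subset_trans cent_O_sub_M; rewrite subsetI (subset_trans (pcore_sub _ _)) //=.
  have nsOG1 : O <| G1 by rewrite (normalS _ sG1G) // (subset_trans sOP).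
  apply/commG1P/trivgP; rewrite -(coprime_TIg (_ : coprime #|'O_p^'(G1)| #|O|)); last first.
    by rewrite coprime_sym (pnat_coprime pO (pcore_pgroup _ _)).
  rewrite subsetI commg_subr commg_subl (subset_trans (normal_sub nsOG1)) ?gFnorm //=.
  by rewrite (subset_trans (pcore_sub _ _)) ?normal_norm.
have pG1M : p.-group (G1 / M).
  rewrite /pgroup card_quotient ?(subset_trans sG1G) //.
  apply: pnat_dvd (indexgS _ E1M) _.
  by have /and3P[_ _] := nilG1; rewrite pnatNK.
case/eqP: ntA0; apply/trivgP.
rewrite -(coprime_TIg (_ : coprime #|A0| #|G1 / M|)); last first.
  by rewrite coprime_sym (pnat_coprime pG1M).
by rewrite subsetI subxx /= -defG1 joing_subl.
Qed.

(** A maximal abelian [A] outside [O] would contain a quadratic subgroup [X] acting nontrivially on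
    [V]. Such an [X] centralises K / M, which contains its own centraliser in G / M. *)
Let J_sub_O : thompsonJ P \subset O.
Proof.
rewrite gen_subG; apply/bigcupsP=> A maxA; apply: contraT => nsAO.
have [sAP abA /eqP oA] := and3P maxA.
have nMG := normal_norm nsMG; have nMP := subset_trans sPG nMG.
have abelV : p.-abelem V.
  by rewrite Ohm1_abelem ?center_abelian // (pgroupS (center_sub _)).
have pV : p.-group V := pgroupS sVO pO.
have cVO : O \subset 'C(V) by rewrite centsC (subset_trans (Ohm_sub _ _)) // subsetIr.
have sub_cV (X : {group gT}) : X \subset P -> (X \subset 'C(V)) = (X \subset O).
  move=> sXP; have sXG := subset_trans sXP sPG.
  apply/idP/idP => [cX | sXO]; last exact: subset_trans cVO.
  have : X \subset M by rewrite -cent_V subsetI sXG.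
  have nsOM : O <| M by rewrite (normalS _ (normal_sub nsMG)) ?joing_subr.
  move=> sXM; by rewrite (sub_normal_Hall hallO nsOM sXM) (pgroupS sXP).
have cAV : 'C_A(V) \subset O by rewrite -sub_cV ?subsetIr // subIset ?sAP.
(* The abelian subgroup C_A(V) V of [P] has order at most |A|, and C_A(V) :&: V lies in C_V(A). *)
have offA : #|'C_A(V)| * #|V| <= #|A| * #|'C_V(A)|.
  have cCV : 'C_A(V) \subset 'C(V) by apply: subsetIr.
  have := mul_cardG 'C_A(V) V; rewrite -cent_joinEr 1?centsC // => ->.
  apply: leq_mul.
    rewrite oA; apply: (@abelian_order_le _ _ ('C_A(V) <*> V)%G).
      by rewrite join_subG subIset ?sAP // (subset_trans sVO).
    rewrite abelianY (abelianS (subsetIl _ _) abA) (abelem_abelian abelV) /=.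
    by rewrite centsC.
  apply: subset_leq_card; rewrite subsetI subsetIr /=.
  by rewrite (subset_trans (subsetIl _ _)) // (subset_trans (subsetIl _ _)).
have nVA : A \subset 'N(V) := subset_trans (subset_trans sAP sPG) nVG.
have [|X [sXA ncX quad]] := quadratic_offender pV (pgroupS sAP pP) (abelem_abelian abelV) abA nVA _ offA.
  by rewrite sub_cV.
case/negP: ncX; have sXP := subset_trans sXA sAP; have sXG := subset_trans sXP sPG.
have sKG := normal_sub nsKG; have nMK := subset_trans sKG nMG.
have p'KM : p^'.-group (K / M).
  rewrite /pgroup card_quotient //.
  apply: (@pnat_dvd _ #|K : O|); first by rewrite indexgS ?joing_subr.
  by rewrite -card_quotient // (subset_trans sKG) // normal_norm.
have cXK : X / M \subset 'C(K / M).
  apply/centsP=> _ /morphimP[x nMx Xx ->] _ /morphimP[y nMy Ky ->].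
  have : [~ x, y] \in 'C_G(V).
    rewrite inE (groupR (subsetP sXG x Xx) (subsetP sKG y Ky)) /=.
    apply: (@quadratic_centralises _ p #|K / M| [group of V] K%G X) => //.
    - by rewrite -p'natE.
    - exact: subset_trans nVG.
    - exact: subset_trans nVG.
    - by rewrite (subset_trans sXG) // normal_norm.
    - by apply: subset_trans (der1_min nMK abelian_KM) _; rewrite /= -cent_V subsetIr.
    move=> z Kz; have nMz := subsetP nMK z Kz.
    suffices: z ^+ #|K / M| \in 'C_G(V) by case/setIP.
    rewrite cent_V; apply: coset_idr; first by rewrite groupX.
    by rewrite morphX //= expg_cardG // mem_quotient.
  rewrite cent_V => Mxy; apply/commgP; rewrite -morphR //=.
  by rewrite coset_id.
(* [C] is the product of K / M and a Sylow [p]-subgroup centralising it; the latter is normal in G /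
   M, hence trivial by [sub_M]. *)
set C := 'C_(G / M)(K / M).
have nsCG : C <| G / M.
  by rewrite /normal subsetIl normsI ?normG // norms_cent // quotient_norms // normal_norm.
have sKC : K / M \subset C by rewrite subsetI quotientS.
have hallK : p^'.-Hall(C) (K / M).
  apply: pHall_subl sKC (subsetIl _ _) _.
  rewrite /pHall quotientS // p'KM /= (index_quotient_eq (subset_trans (subsetIr G _) sMK) sKG nMG).
  by rewrite pnatNK.
have nsKC : K / M <| C by rewrite /normal sKC cents_norm ?subsetIr.
have [S sylS] := Sylow_exists p [group of C].
have defC : K / M * S = C by have [] := sdprodP (sdprod_normal_pHallP nsKC sylS hallK).
have nsSC : S <| C.
  rewrite /normal (pHall_sub sylS) -defC mulG_subG normG andbT cents_norm // centsC.
  by rewrite (subset_trans (pHall_sub sylS)) // subsetIr.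
have S1 : S :=: 1.
  have nsSG : S <| G / M.
    by rewrite -(normal_Hall_pcore sylS nsSC) gFnormal_trans.
  have [T defS sMT nsTG] := inv_quotientN nsMG nsSG.
  have sTM : T \subset M by apply: sub_M; rewrite // -defS (pHall_pgroup sylS).
  by rewrite defS; apply/trivgP; rewrite quotient_sub1 ?(subset_trans sTM) ?normG.
have XM1 : X / M = 1.
  apply/trivgP; rewrite -(coprime_TIg (_ : coprime #|X / M| #|K / M|)); last first.
    by rewrite (pnat_coprime (quotient_pgroup _ (pgroupS sXP pP))).
  rewrite subsetI subxx /=.
  have -> : K / M = C by rewrite -defC S1 mulg1.
  by rewrite subsetI quotientS.
have : X \subset M by rewrite -quotient_sub1 ?XM1 ?(subset_trans sXG).
by rewrite -cent_V subsetI => /andP[].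
Qed.

(** J(P) = J(O) is normal in [G], so [nilJ] concerns [G] itself. *)
Lemma Thompson_configuration : False.
Proof.
have eqJ := thompsonJ_eq sOP J_sub_O.
case/negP: not_nilG; move: nilJ; rewrite -eqJ (setIidPl _) //.
by rewrite (subset_trans (normal_norm nsOG)) // thompsonJ_norm.
Qed.

End ThompsonConfiguration.

Lemma pgroup_card_le_part (gT : finGroupType) (p : nat) (H K : {group gT}) :
  p.-group H -> H \subset K -> #|H| <= #|K|`_p.
Proof.
move=> pH sHK; rewrite -(part_pnat_id pH) dvdn_leq ?part_gt0 //.
by rewrite partn_dvd ?cardSg.
Qed.

(** In a minimal counterexample, Frobenius' criterion yields a nontrivial [p]-subgroup X with N_G(X)
    not [p]-nilpotent. Taking |N_G(X)|_p and then |X| maximal forces X to be normal and G / O_p(G)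
    to be [p]-nilpotent, which is the excluded configuration. *)
Theorem Thompson_p_nilpotent (gT : finGroupType) (p : nat) (G P : {group gT}) :
    prime p -> odd p -> p.-Sylow(G) P ->
    p_nilpotent p 'N_G(thompsonJ P) -> p_nilpotent p 'C_G('Ohm_1('Z(P))) ->
  p_nilpotent p G.
Proof.
move=> p_pr odd_p; have [n] := ubnP #|G|.
elim: n gT G P => // n IHn gT G P /ltnSE-leGn sylP nilJP nilZP.
apply: contraT => not_nil.
have hypQ (Q : {group gT}) : p.-Sylow(G) Q ->
    p_nilpotent p 'N_G(thompsonJ Q) /\ p_nilpotent p 'C_G('Ohm_1('Z(Q))).
  move=> sylQ; have [x Gx ->] := Sylow_trans sylP sylQ.
  have -> : 'N_G(thompsonJ (P :^ x)) = 'N_G(thompsonJ P) :^ x.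
    by rewrite thompsonJJ normJ conjIg (conjGid Gx).
  have -> : 'C_G('Ohm_1('Z(P :^ x))) = 'C_G('Ohm_1('Z(P))) :^ x.
    have -> : 'Z(P :^ x) = 'Z(P) :^ x by rewrite /center centJ -conjIg.
    by rewrite OhmJ centJ conjIg (conjGid Gx).
  by rewrite !p_nilpotentJ.
have IHsub (H Q : {group gT}) :
    p.-Sylow(G) Q -> Q \subset H -> H \proper G -> p_nilpotent p H.
  move=> sylQ sQH prHG; have [nilJ nilZ] := hypQ Q sylQ.
  have sHG := proper_sub prHG.
  apply: (IHn _ H Q); first exact: leq_trans (proper_card prHG) leGn.
  - exact: pHall_subl sylQ.
  - by apply: p_nilpotentS nilJ; rewrite setSI.
  by apply: p_nilpotentS nilZ; rewrite setSI.
pose bad (X : {group gT}) :=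
  [&& X \subset G, p.-group X, X :!=: 1 & ~~ p_nilpotent p 'N_G(X)].
have [/existsP[X0 badX0] | noX] := boolP [exists X, bad X]; last first.
  case/negP: not_nil; apply: Frobenius_p_nilpotent => // X sXG pX ntX.
  apply: contraNT noX => nilX; apply/existsP; exists X.
  by rewrite /bad sXG pX ntX.
(* The weight |G| + 1 exceeds every |X|, so [f] orders the pairs lexicographically. *)
pose f (X : {group gT}) := (#|'N_G(X)|`_p * #|G|.+1 + #|X|)%N.
have [X /and4P[sXG pX ntX nilX] maxX] := @arg_maxnP _ X0 bad f badX0.
have maxp (Y : {group gT}) : Y \subset G -> p.-group Y -> Y :!=: 1 ->
    (#|'N_G(X)|`_p < #|'N_G(Y)|`_p) ||
      (#|'N_G(X)|`_p <= #|'N_G(Y)|`_p) && (#|X| < #|Y|) ->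
  p_nilpotent p 'N_G(Y).
  move=> sYG pY ntY ltXY; apply: contraLR ltXY => nilY.
  have /maxX : bad Y by rewrite /bad sYG pY ntY.
  rewrite /f => le_f; have leX := subset_leq_card sXG; have leY := subset_leq_card sYG.
  apply/negP; case/orP => [lt1 | /andP[le1 lt2]].
    move: le_f; apply/negP; rewrite -ltnNge.
    apply: (@leq_trans ((#|'N_G(X)|`_p).+1 * #|G|.+1)).
      by rewrite mulSn addnC ltn_add2r ltnS.
    by apply: leq_trans (leq_addr _ _); rewrite leq_mul2r lt1 orbT.
  move: le_f; apply/negP; rewrite -ltnNge -addnS.
  by apply: leq_add lt2; rewrite leq_mul2r le1 orbT.
set N := 'N_G(X) in nilX maxp.
have sNG : N \subset G by apply: subsetIl.
have nsXN : X <| N by rewrite /normal subsetIr subsetI sXG normG.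
have [R sylR] := Sylow_exists p [group of N].
have [sRN pR _] := and3P sylR.
have sXR : X \subset R.
  by apply: subset_trans (pcore_sub_Hall sylR); apply: pcore_max.
have ntR : R :!=: 1 by apply: contraNneq ntX => R1; rewrite -subG1 -R1.
have [P1 sylP1 sRP1] := Sylow_superset (subset_trans sRN sNG) pR.
have [sP1G pP1 _] := and3P sylP1; have [nilJ1 nilZ1] := hypQ P1 sylP1.
have sP1N : P1 \subset N.
  (* If [R] were not Sylow in [G], normalisers of nontrivial subgroups characteristic in [R] would
     have larger [p]-part than [N], hence be [p]-nilpotent; induction would then make [N]
     [p]-nilpotent. *)
  suffices /eqP <- : R :==: P1 by [].
  rewrite eqEproper sRP1; apply: contra nilX => prR.
  have prN := nilpotent_proper_norm (pgroup_nil pP1) prR.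
  have sRG := subset_trans sRN sNG.
  have step (Y : {group gT}) : Y \subset R -> Y :!=: 1 -> 'N(R) \subset 'N(Y) ->
      p_nilpotent p 'N_G(Y).
    move=> sYR ntY nYR; apply: maxp; rewrite ?(subset_trans sYR) ?(pgroupS sYR) //.
    rewrite -(card_Hall sylR) (leq_trans (proper_card prN)) //.
    apply: pgroup_card_le_part; first exact: pgroupS (subsetIl _ _) pP1.
    exact: setISS.
  apply: (IHn _ [group of N] R) => //.
  - apply: leq_trans leGn; apply: proper_card; rewrite properEneq sNG andbT.
    apply: contraTneq prR => defN; rewrite properEcard sRP1 /=.
    by rewrite (card_Hall sylR) (card_Hall sylP1) defN ltnn.
  - apply: p_nilpotentS (step (thompsonJ R)%G _ _ _); rewrite ?setSI ?thompsonJ_sub //.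
      exact: thompsonJ_neq1.
    exact: thompsonJ_norm.
  - have sZR : 'Ohm_1('Z(R)) \subset R by rewrite (subset_trans (Ohm_sub _ _)) ?center_sub.
    apply: p_nilpotentS (step ('Ohm_1('Z(R)))%G _ _ _) => //.
    + by apply: setISS; rewrite ?cent_sub.
    + by rewrite Ohm1_eq1 center_nil_eq1 ?(pgroup_nil pR).
    by rewrite !gFnorm_trans.
have defN : N = G.
  apply/eqP; rewrite eqEproper sNG; apply: contra nilX.
  exact: IHsub sylP1 sP1N.
have nXG : G \subset 'N(X) by rewrite -defN subsetIr.
have sXO : X \subset 'O_p(G) by rewrite pcore_max // /normal sXG.
have ntO : 'O_p(G) != 1 by apply: contraNneq ntX => O1; rewrite -subG1 -O1.
have nsOG := pcore_normal p G; have nOG := normal_norm nsOG.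
have sOP1 : 'O_p(G) \subset P1 := pcore_sub_Hall sylP1.
have nsOP1 : 'O_p(G) <| P1 by apply: normalS nsOG.
have sylPb : p.-Sylow(G / 'O_p(G)) (P1 / 'O_p(G)).
  by apply: quotient_pHall sylP1; apply: subset_trans nOG.
(* Subgroups of P1 properly containing the core are larger than [X]; for those normal in P1
   maximality makes the normaliser [p]-nilpotent, so G / O_p(G) satisfies the hypotheses of the
   induction. *)
have nilGO : p_nilpotent p (G / 'O_p(G)).
  have [P1b | ntPb] := eqsVneq (P1 / 'O_p(G)) 1.
    apply: (@normal_complement_p_nilpotent _ _ _ (G / 'O_p(G))%G); rewrite ?normal_refl //.
    by rewrite /pHall subxx indexgg /= andbT -partG_eq1 -(card_Hall sylPb) /= P1b cards1.
  have step (Yb : {group coset_of 'O_p(G)}) : Yb <| P1 / 'O_p(G) -> Yb :!=: 1 ->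
      p_nilpotent p 'N_(G / 'O_p(G))(Yb).
    move=> nsYb ntYb; have [Y defY sOY nsYP] := inv_quotientN nsOP1 nsYb.
    have [sYP nYP] := andP nsYP; have sYG := subset_trans sYP sP1G.
    have nsOY : 'O_p(G) <| Y by apply: normalS nsOG.
    rewrite defY -quotient_subnormG //; apply: p_nilpotent_quotient.
      by rewrite subIset ?nOG.
    have prO : 'O_p(G) \proper Y.
      rewrite properEneq sOY andbT; apply: contraNneq ntYb => defO.
      by rewrite defY -defO trivg_quotient.
    apply: maxp; rewrite ?(pgroupS sYP) //.
      by apply: contraNneq ntO => Y1; rewrite -subG1 -Y1.
    apply/orP; right.
    rewrite (leq_ltn_trans (subset_leq_card sXO) (proper_card prO)) andbT.
    rewrite defN -(card_Hall sylP1); apply: pgroup_card_le_part => //.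
    by rewrite subsetI sP1G.
  apply: (IHn _ _ (P1 / 'O_p(G))%G) => //.
  - exact: leq_trans (ltn_quotient ntO (pcore_sub _ _)) leGn.
  - apply: step; last exact: thompsonJ_neq1.
    rewrite /normal thompsonJ_sub.
    by rewrite (subset_trans (normG _)) // thompsonJ_norm.
  have sZR : 'Ohm_1('Z(P1 / 'O_p(G))) \subset P1 / 'O_p(G).
    by rewrite (subset_trans (Ohm_sub _ _)) ?center_sub.
  apply: p_nilpotentS (step ('Ohm_1('Z(P1 / 'O_p(G))))%G _ _) => //.
  + by apply: setIS; rewrite cent_sub.
  + by rewrite !gFnormal_trans.
  rewrite Ohm1_eq1 center_nil_eq1 //.
  by apply: (@pgroup_nil _ p); rewrite quotient_pgroup.
case: (Thompson_configuration p_pr odd_p sylP1 nilGO _ nilJ1 nilZ1 not_nil) => H sPH.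
exact: IHsub sylP1 sPH.
Qed.

(** * Fixed-point-free action of a group of prime order *)

Section FmodSums.

Variables (gT : finGroupType) (V : {group gT}) (abV : abelian V).
Implicit Types (B S : {group gT}) (v : fmod_of abV).

Lemma actr_sum (I : finType) (P : pred I) (F : I -> fmod_of abV) x :
  actr (\sum_(i | P i) F i)%R x = (\sum_(i | P i) actr (F i) x)%R.
Proof. exact: (big_morph (fun u => actr u x) (actAr x) (act0r abV x)). Qed.

Lemma sum_actr_fixed B v y :
  B \subset 'N(V) -> y \in B ->
  actr (\sum_(b in B) actr v b)%R y = (\sum_(b in B) actr v b)%R.
Proof.
move=> nVB By; rewrite actr_sum [RHS](reindex_inj (mulIg y)) /=.
apply: eq_big => [b | b Bb]; first by rewrite groupMr.
by rewrite actrM ?(subsetP nVB).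
Qed.

(** The sum is fixed by [B], so it lies in C_V(B). *)
Lemma sum_actr_eq0 B v :
  B \subset 'N(V) -> 'C_V(B) = 1 -> (\sum_(b in B) actr v b = 0)%R.
Proof.
move=> nVB CB1; apply: fmod_inj; rewrite fmval0.
apply/set1P; rewrite -[[set 1]]CB1 inE fmodP; apply/centP=> y By.
apply/commgP/conjg_fixP; rewrite -fmvalJ ?(subsetP nVB) //.
by congr fmval; apply: sum_actr_fixed.
Qed.

(* Summing v^x over the elements x of the conjugates A^s, s in S, gives
   |S| v = sum over S of v^t, because t |-> [a, t] permutes S for a != 1 in A. *)
Lemma Frobenius_cent_abelian (A S : {group gT}) :
    prime #|A| -> A \subset 'N(S) -> 'C_S(A) = 1 ->
    A \subset 'N(V) -> S \subset 'N(V) -> 'C_V(A) = 1 -> coprime #|V| #|S| ->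
  S \subset 'C(V).
Proof.
move=> prA nSA CSA nVA nVS CVA coVS.
have fpf a : a \in A -> a != 1 -> 'C_S[a] = 1.
  move=> Aa nta; rewrite -cent_cycle -[RHS]CSA; congr (_ :&: 'C(_)).
  apply/eqP; rewrite eqEcard cycle_subG Aa /=.
  have : #[a] %| #|A| by apply: order_dvdG.
  have nt1 : #[a] != 1%N by rewrite order_eq1.
  by move/(prime_nt_dvdP prA nt1); rewrite orderE => ->.
have sumS (v : fmod_of abV) : (v *+ #|S| = \sum_(t in S) actr v t)%R.
  have sum0 : (\sum_(s in S) \sum_(a in A) actr v (a ^ s) = 0)%R.
    apply: big1 => s Ss.
    rewrite -[RHS](@sum_actr_eq0 (A :^ s)%G v).
    - rewrite [RHS](reindex_inj (conjg_inj s)) /=.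
      by apply: eq_bigl => a; rewrite memJ_conjg.
    - exact: conj_subG (subsetP nVS s Ss) nVA.
    rewrite /= centJ -{1}(normP (subsetP nVS s Ss)) -conjIg CVA conjs1g //.
  have sumA : (\sum_(a in A) actr v a = 0)%R by apply: sum_actr_eq0.
  have inner a : a \in A -> a != 1 ->
      (\sum_(s in S) actr v (a ^ s) = \sum_(t in S) actr (actr v a) t)%R.
    move=> Aa nta.
    have inj_a : {in S &, injective (fun s => [~ a, s])}.
      move=> s t Ss St /= eq_st.
      have eqJ : a ^ s = a ^ t by rewrite !conjg_mulR eq_st.
      have : s * t^-1 \in 'C_S[a].
        rewrite inE groupM ?groupV //=; apply/cent1P/esym/commgP/conjg_fixP.
        by rewrite conjgM eqJ conjgK.
      by rewrite fpf // => /set1P/eqP; rewrite -eq_mulgV1 => /eqP.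
    have imS : [set [~ a, s] | s in S] = S.
      apply/eqP; rewrite eqEcard (card_in_imset inj_a) leqnn andbT.
      apply/subsetP=> _ /imsetP[s Ss ->].
      by rewrite commgEr groupMr // memJ_norm ?groupV // (subsetP nSA).
    rewrite -{2}imS (big_imset _ inj_a) /=; apply: eq_bigr => s Ss.
    have Sas : [~ a, s] \in S by rewrite -imS imset_f.
    by rewrite -(actrM (subsetP nVA a Aa) (subsetP nVS _ Sas)) conjg_mulR.
  rewrite exchange_big /= (bigD1 1) //= in sum0.
  rewrite (eq_bigr (fun=> v)) in sum0; last by move=> s _; rewrite conj1g actr1.
  rewrite sumr_const in sum0.
  rewrite (eq_bigr (fun a => \sum_(t in S) actr (actr v a) t)%R) in sum0; last first.
    by move=> a /andP[]; apply: inner.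
  (* The same double sum taken over [A] first also vanishes; comparing the terms at a = 1 gives the
     identity. *)
  have : (\sum_(a in A) \sum_(t in S) actr (actr v a) t = 0)%R.
    rewrite exchange_big /=; apply: big1 => t St.
    by rewrite -actr_sum sumA act0r.
  rewrite (bigD1 1) //= (eq_bigr (fun t => actr v t)) ?actr1 // => sum1.
  by apply: (addIr (\sum_(i in A | i != 1%g) \sum_(t in S) actr (actr v i) t)%R); rewrite sum0 sum1.
(* By [sumS] the multiple |S| v is fixed by [S], and |S| is invertible on [V]. *)
rewrite centsC; apply/centsP=> v Vv t St.
have nVt := subsetP nVS t St.
have := sum_actr_fixed (fmod abV v) nVS St; rewrite -sumS actZr => fix_t.
have := congr1 (@fmval _ _ abV) fix_t; rewrite !fmvalZ fmvalJ // fmodK //.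
have Vvt : v ^ t \in V by rewrite memJ_norm.
move=> eq_vt; apply/commgP/conjg_fixP.
by rewrite -(expgK coVS Vvt) eq_vt expgK.
Qed.

End FmodSums.

(** Counting fixed points gives |M| = |C_M(A)| = 1 modulo the prime |A|. *)
Lemma fpf_coprime (gT : finGroupType) (A M : {group gT}) :
  prime #|A| -> A \subset 'N(M) -> 'C_M(A) = 1 -> coprime #|M| #|A|.
Proof.
move=> prA nMA CM1; rewrite coprime_sym prime_coprime //.
have pA : #|A|.-group A by rewrite /pgroup pnat_id.
have actsM : [acts A, on M | 'J] by rewrite astabsJ.
have := pgroup_fix_mod pA actsM; rewrite afixJ CM1 cards1 => eq_mod.
by rewrite /dvdn eq_mod modn_small ?prime_gt1.
Qed.

Lemma normal_Sylows_nilpotent (gT : finGroupType) (M : {group gT}) :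
  (forall q, prime q -> q.-Sylow(M) 'O_q(M)) -> nilpotent M.
Proof.
move=> nS; suffices /eqP <- : 'F(M) :==: M by apply: Fitting_nil.
rewrite eqEsubset Fitting_sub -{1}(Sylow_gen M) gen_subG.
apply/bigcupsP=> S /SylowP[q q_pr sylS].
have [x Mx ->] := Sylow_trans (nS q q_pr) sylS.
rewrite (normsP (gFnorm _ _)) // Fitting_max ?pcore_normal //.
exact: pgroup_nil (pcore_pgroup q M).
Qed.

(** In a minimal counterexample no nontrivial nilpotent normal subgroup is [A]-invariant ([solve]).
    So for an odd prime q and an [A]-invariant Sylow q-subgroup Q, the local subgroups in Thompson's
    criterion are proper, hence nilpotent; the resulting normal q-complement is again nilpotent. *)
Theorem fpf_prime_nilpotent (gT : finGroupType) (A M : {group gT}) :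
  prime #|A| -> A \subset 'N(M) -> 'C_M(A) = 1 -> nilpotent M.
Proof.
have [n] := ubnP #|M|; elim: n gT A M => // n IHn gT A M /ltnSE-leMn prA nMA CM1.
have coMA := fpf_coprime prA nMA CM1.
have solA : solvable A by apply/abelian_sol/cyclic_abelian/prime_cyclic.
have subC (H : {group gT}) : H \subset M -> 'C_H(A) = 1.
  by move=> sHM; apply/trivgP; rewrite -CM1 setSI.
have IHs (H : {group gT}) : H \proper M -> A \subset 'N(H) -> nilpotent H.
  move=> prHM nHA; apply: (IHn _ A) => //; last exact/subC/proper_sub.
  exact: leq_trans (proper_card prHM) leMn.
have IHq (H : {group gT}) : H <| M -> A \subset 'N(H) -> H :!=: 1 -> nilpotent (M / H).
  move=> nsHM nHA ntH; have [sHM nHM] := andP nsHM.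
  apply: (IHn _ (A / H)%G).
  - exact: leq_trans (ltn_quotient ntH sHM) leMn.
  - rewrite -(card_isog (quotient_isog nHA _)) //.
    by apply: coprime_TIg; apply: coprimeSg coMA.
  - exact: quotient_norms.
  (* By coprime action, fixed points of [A] on M / H come from fixed points in [M]. *)
  have <- := @strongest_coprime_quotient_cent _ A M H nHA _ _ _.
  - by rewrite CM1 quotient1.
  - by rewrite subIset ?sHM.
  - by apply: coprimeSg coMA; rewrite subIset ?sHM.
  by rewrite solA orbT.
have solve (H : {group gT}) : H <| M -> A \subset 'N(H) -> H :!=: 1 -> nilpotent H -> nilpotent M.
  move=> nsHM nHA ntH nilH.
  have [r r_pr rH] : exists2 r, prime r & r %| #|H|.
    by have [H1|//] := trivgVpdiv H; rewrite H1 eqxx in ntH.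
  pose V := 'Ohm_1('Z('O_r(H)))%G.
  have rO := pcore_pgroup r H.
  have abelV : r.-abelem V.
    by rewrite Ohm1_abelem ?center_abelian // (pgroupS (center_sub _)).
  have abV := abelem_abelian abelV; have rV := abelem_pgroup abelV.
  have nsVM : V <| M by rewrite !gFnormal_trans.
  have [sVM nVM] := andP nsVM.
  have nVA : A \subset 'N(V) by rewrite !gFnorm_trans.
  have ntV : V :!=: 1.
    rewrite /= Ohm1_eq1 center_nil_eq1 ?(pgroup_nil rO) // -cardG_gt1.
    by rewrite (card_Hall (nilpotent_pcore_Hall r nilH)) p_part_gt1 mem_primes r_pr cardG_gt0.
  have nilMV := IHq V nsVM nVA ntV.
  (* M / V is nilpotent by induction, so V S is normal for an [A]-invariant Sylow subgroup S. If V S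
     is proper it is nilpotent and S is characteristic in it; if V S = M, either M is an s-group or
     S centralises V by [Frobenius_cent_abelian]. *)
  apply: normal_Sylows_nilpotent => s s_pr.
  have [S sylS nSA] := sol_coprime_Sylow_exists s solA nMA coMA.
  have [sSM sS _] := and3P sylS.
  suffices nsSM : S <| M by rewrite (normal_Hall_pcore sylS nsSM).
  have nVS := subset_trans sSM nVM.
  have nsVSM : V <*> S <| M.
    have : S / V <| M / V.
      have sylSV : s.-Sylow(M / V) (S / V) by apply: quotient_pHall.
      have sylO := nilpotent_pcore_Hall s nilMV.
      by rewrite (eq_Hall_pcore sylO sylSV) pcore_normal.
    by rewrite -cosetpre_normal quotientK // (quotientGK nsVM) norm_joinEr.
  have nVSA : A \subset 'N(V <*> S) by rewrite normsY.
  have sSVS : S \subset V <*> S by apply: joing_subr.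
  have sylSVS : s.-Sylow(V <*> S) S.
    by apply: pHall_subl sylS; rewrite ?(normal_sub nsVSM).
  have [prVS | nprVS] := boolP (V <*> S \proper M).
    have nilVS := IHs (V <*> S)%G prVS nVSA.
    have <- : 'O_s(V <*> S) = S.
      exact/esym/(eq_Hall_pcore (nilpotent_pcore_Hall s nilVS) sylSVS).
    exact: gFnormal_trans.
  have defM : V <*> S = M by apply/eqP; rewrite eqEproper nprVS (normal_sub nsVSM).
  have [rs | nrs] := eqVneq r s.
    have sM : s.-group M by rewrite -defM /= norm_joinEr // pgroupM sS andbT -rs.
    by rewrite (pHall_id sylS sM) normal_refl.
  have coVS : coprime #|V| #|S|.
    apply: (pnat_coprime rV); apply: sub_in_pnat sS => x _ /eqP ->.
    by rewrite !inE eq_sym.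
  have cVS : S \subset 'C(V) by apply: (Frobenius_cent_abelian abV prA nSA) => //; apply: subC.
  by rewrite -defM /normal sSVS join_subG normG andbT cents_norm // centsC.
have [m1 | ntm] := eqVneq (#|M|`_2^')%N 1%N.
  by apply: (@pgroup_nil _ 2); rewrite -pgroupNK -partG_eq1 m1.
have m_gt1 : 1 < #|M|`_2^' by rewrite ltn_neqAle eq_sym ntm part_gt0.
pose q := pdiv #|M|`_2^'; have q_pr : prime q by apply: pdiv_prime.
have qm : q %| #|M|`_2^' by apply: pdiv_dvd.
have qM : q %| #|M| by apply: dvdn_trans qm (dvdn_part _ _).
have odd_q : odd q by rewrite odd_2'nat (pnat_dvd qm) ?part_pnat.
have [Q sylQ nQA] := sol_coprime_Sylow_exists q solA nMA coMA.
have [sQM qQ _] := and3P sylQ.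
have ntQ : Q :!=: 1.
  by rewrite -cardG_gt1 (card_Hall sylQ) p_part_gt1 mem_primes q_pr cardG_gt0.
have local (Y : {group gT}) : Y \subset Q -> Y :!=: 1 -> A \subset 'N(Y) ->
    ~~ nilpotent M -> p_nilpotent q 'N_M(Y).
  move=> sYQ ntY nYA; apply: contraNT => nilNY.
  have defN : 'N_M(Y) = M.
    apply/eqP; rewrite eqEproper subsetIl; apply: contra nilNY => prN.
    by apply/nilpotent_p_nilpotent/IHs; rewrite // normsI // norms_norm.
  apply: (solve Y) => //; last exact: pgroup_nil (pgroupS sYQ qQ).
  by rewrite /normal (subset_trans sYQ) // -{1}defN subsetIr.
apply: contraT => not_nil; case/negP: (not_nil).
have nilM : p_nilpotent q M.
  apply: (Thompson_p_nilpotent q_pr odd_q sylQ).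
    apply: (local (thompsonJ Q)%G); rewrite ?thompsonJ_sub ?thompsonJ_neq1 //.
    exact: subset_trans (thompsonJ_norm Q).
  have sZ : 'Ohm_1('Z(Q)) \subset Q by rewrite (subset_trans (Ohm_sub _ _)) ?center_sub.
  apply: p_nilpotentS (local ('Ohm_1('Z(Q)))%G _ _ _ _) => //.
  - by rewrite setIS ?cent_sub.
  - by rewrite Ohm1_eq1 center_nil_eq1 ?(pgroup_nil qQ).
  by rewrite !gFnorm_trans.
have nKA : A \subset 'N('O_q^'(M)) by rewrite gFnorm_trans.
have [K1 | ntK] := eqsVneq 'O_q^'(M) 1.
  apply: (@pgroup_nil _ q); have /and3P[_ _] := nilM.
  by rewrite K1 indexg1 pnatNK.
apply: (solve 'O_q^'(M)%G) => //; first exact: pcore_normal.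
apply: IHs => //; rewrite properEneq pcore_sub andbT.
apply: contraTneq qM => defK; rewrite -p'natE // -defK.
exact: pcore_pgroup.
Qed.

(** * Characters of GC*-groups *)

Section GaloisConjugateCharacters.
Local Open Scope ring_scope.

Lemma cfDet_aut (gT : finGroupType) (G : {group gT}) (u : {rmorphism algC -> algC})
    (phi : 'CF(G)) :
  phi \is a character -> cfDet (cfAut u phi) = cfAut u (cfDet phi).
Proof.
case/char_reprP=> rG ->; rewrite -cfRepr_map !cfDetRepr.
by apply/cfun_inP=> x Gx; rewrite !cfunE Gx !trace_mx11 !mxE /= det_map_mx.
Qed.

Lemma cfDet_order_aut (gT : finGroupType) (G : {group gT}) (u : {rmorphism algC -> algC})
    (phi : 'CF(G)) :
  phi \is a character -> 'o(cfAut u phi)%CF = 'o(phi)%CF.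
Proof. by move=> Nphi; rewrite /cfDet_order cfDet_aut // cforder_aut. Qed.

Lemma cfDet_order_conjg (gT : finGroupType) (G : {group gT}) (phi : 'CF(G)) y :
  y \in 'N(G)%g -> 'o(phi ^ y)%CF = 'o(phi)%CF.
Proof. by move=> nGy; rewrite /cfDet_order cfConjgEin cfDetIsom cforder_isom. Qed.

Lemma irr1_natr (gT : finGroupType) (G : {group gT}) (i : Iirr G) :
  (Num.truncn ('chi_i 1%g))%:R = 'chi_i 1%g.
Proof. exact/truncnK/Cnat_irr1. Qed.

Lemma irr1_dvdn (gT : finGroupType) (G : {group gT}) (i : Iirr G) :
  (Num.truncn ('chi_i 1%g) %| #|G|)%N.
Proof. by have := dvd_irr1_cardG i; rewrite -{1}irr1_natr dvdC_nat. Qed.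

(** Multiplying the character, of degree d and determinant m, by a linear n keeps the degree and
    turns the determinant into n^d m, so n^d m and m have equal order for all n. If p did not divide
    d, one choice of n removes the [p]-part of m and another puts a [p]-part back. *)
Lemma GCstar_dvd_irr1 (gT : finGroupType) (G : {group gT}) (p : nat) (i : Iirr G) :
    GCstar G -> prime p -> (p %| #|G : G^`(1)%g|)%N -> 'chi_i 1%g != 1 ->
  (p %| Num.truncn ('chi_i 1%g))%N.
Proof.
move=> gcG p_pr pG' nl_i; set d := Num.truncn _.
have [linG [cF [injF oL linF onF] [cF1 cFM cFX cFV cFo]]] := lin_char_group G.
have [m def_m] := onF _ (cfDet_lin_char 'chi_i).
have cL (u v : linG) : commute u v by apply: injF; rewrite !cFM mulrC.
have eq_o n : #[(n ^+ d * m)%g] = #[m].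
  rewrite -!cFo cFM cFX -def_m -cfDet_mul_lin ?irr_char //.
  have /irrP[j def_j] := mul_lin_irr (linF n) (mem_irr i).
  have j1 : 'chi_j 1%g = 'chi_i 1%g by rewrite -def_j cfunE lin_char1 ?mul1r.
  have [||u def_u] := gcG i j nl_i; rewrite ?j1 //.
  by rewrite def_j -[#[cfDet _]%CF]/'o(_)%CF -def_u cfDet_order_aut ?irr_char.
apply: contraT => p'd.
have p'm : (p^').-elt m.
  (* The exponent inverts [d] modulo the order of [x], giving n with n^d the inverse of the [p]-part
     of [m]. *)
  set x := (m.`_p)^-1%g; have px : p.-elt x by rewrite p_eltV p_elt_constt.
  have cox : coprime #|<[x]>| d.
    by rewrite -orderE (pnat_coprime px) // p'natE.
  have := eq_o (x ^+ expg_invn <[x]> d)%g.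
  rewrite -expgM mulnC expgM expgK ?cycle_id // /x -{2}(consttC p m) mulKg.
  by rewrite /p_elt => <-; apply: p_elt_constt.
have [l _ ol] : {l : linG | l \in [set: linG] & #[l] = p}.
  by apply: Cauchy; rewrite // cardsT oL.
have pl : p.-elt l by rewrite /p_elt ol pnat_id.
have : (p^').-elt (l ^+ d * m)%g by rewrite /p_elt eq_o.
move/constt1P; rewrite consttM; last exact: cL.
have /constt1P -> := p'm; rewrite mulg1 consttX (constt_p_elt pl) => /eqP.
by rewrite -order_dvdn ol (negPf p'd).
Qed.

(** At a [p']-element y the value is a root of unity whose order divides both #[y] and o, hence the
    [p']-part of o. That power of [xi] is thus trivial on generators. *)
Lemma p'elt_gen_lin_char_order (gT : finGroupType) (N : {group gT}) (p : nat) (xi : 'CF(N)) :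
    N \subset <<[set x in N | p^'.-elt x]>>%g -> xi \is a linear_char ->
  p^'.-nat #[xi]%CF.
Proof.
move=> genN lin_xi; set o := #[xi]%CF.
have o_gt0 : (0 < o)%N by apply: cforder_lin_char_gt0.
suffices : (o %| o`_p^')%N by move/pnat_dvd; apply; apply: part_pnat.
apply/dvdn_cforderP=> x Nx.
have lin_k : xi ^+ o`_p^' \is a linear_char by rewrite rpredX.
suffices /subsetP/(_ x Nx)/cfker1 : N \subset cfker (xi ^+ o`_p^').
  by rewrite exp_cfunE // [RHS]lin_char1.
apply: subset_trans genN _; rewrite gen_subG; apply/subsetP=> y.
rewrite inE => /andP[Ny p'y]; suffices: y \in cfker (xi ^+ o`_p^') by [].
rewrite cfkerEchar ?lin_charW // inE Ny /= lin_char1 // exp_cfunE //.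
have y1 : xi y ^+ #[y] = 1 by apply: lin_char_unity_root.
have yo : xi y ^+ o = 1 by apply/(dvdn_cforderP (dvdnn o)).
have [k prim_k ko] := prim_order_exists o_gt0 yo.
have ky : (k %| #[y])%N by rewrite (prim_order_dvd prim_k) y1.
rewrite -(prim_order_dvd prim_k) -(part_pnat_id (pnat_dvd ky p'y)).
exact: partn_dvd.
Qed.

(* The subgroup N generated by the p'-elements of G has |N| = |N : N'| modulo
   p, because a nonlinear irreducible character of N of degree prime to p is
   not G-invariant: it would extend to G. *)
Theorem dvd_irr1_p_nilpotent (gT : finGroupType) (G : {group gT}) (p : nat) :
    prime p ->
    (forall i : Iirr G, 'chi_i 1%g != 1 -> (p %| Num.truncn ('chi_i 1%g))%N) ->
  p_nilpotent p G.
Proof.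
move=> p_pr pG; pose X := [set x in G | p^'.-elt x]; pose N := <<X>>%G.
have sNG : N \subset G by rewrite gen_subG; apply/subsetP=> x; rewrite inE => /andP[].
have nNG : G \subset 'N(N)%g.
  apply: norms_gen; apply/subsetP=> y Gy; rewrite inE; apply/subsetP=> _ /imsetP[x Xx ->].
  by case/setIdP: Xx => Gx p'x; rewrite inE groupJ ?p_eltJ.
have nsNG : (N <| G)%g by apply/andP.
have genN : N \subset <<[set x in N | p^'.-elt x]>>%g.
  apply: genS; apply/subsetP=> x Xx; rewrite inE mem_gen //=.
  by move: Xx; rewrite inE => /andP[].
(* The [p']-part of any element of [G] lies in [N], so G / N consists of [p]-elements. *)
have pGN : p.-nat #|G : N|%g.
  rewrite -card_quotient //; apply/pgroupP=> q q_pr qG.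
  have [_ /morphimP[x nNx Gx ->] oy] := Cauchy q_pr qG.
  have : p.-elt (coset N x).
    rewrite -(consttC p x) morphM ?groupX //=.
    have -> : coset N x.`_p^' = 1%g.
      by rewrite coset_id // mem_gen // inE groupX ?p_elt_constt.
    by rewrite mulg1 (morph_p_elt (coset_morphism N)) ?groupX ?p_elt_constt.
  by rewrite /p_elt oy pnatE.
have solGN : solvable (G / N) by apply: (@pgroup_sol _ p); rewrite /pgroup card_quotient.
apply: (@normal_complement_p_nilpotent _ _ _ N) => //.
rewrite /pHall sNG (eq_pnat _ (negnK _)) pGN andbT /= /pgroup p'natE //.
have p'N' : ~~ (p %| #|N : N^`(1)|%g)%N.
  have [linN [cF [_ <- linF _] [_ _ _ _ cFo]]] := lin_char_group N.
  apply/negP; rewrite -cardsT => /(Cauchy p_pr)[l _ ol].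
  have := p'elt_gen_lin_char_order genN (linF l).
  by rewrite cFo ol p'natE // dvdnn.
pose d (t : Iirr N) := Num.truncn ('chi_t 1%g).
have oN : #|N| = (\sum_t d t ^ 2)%N.
  apply/eqP; rewrite -(eqr_nat algC) -irr_sum_square natr_sum; apply/eqP.
  by apply: eq_bigr => t _; rewrite natrX irr1_natr.
have lin1 (t : Iirr N) : ('chi_t \is a linear_char) = (d t == 1%N).
  by rewrite qualifE /= irr_char /= -(eqr_nat algC) irr1_natr.
rewrite oN (bigID (fun t => 'chi_t \is a linear_char)) /=.
rewrite (eq_bigr (fun=> 1%N)); last by move=> t; rewrite lin1 => /eqP ->.
rewrite sum1_card card_lin_irr dvdn_addl //.
(* Nonlinear characters are grouped into [G]-orbits; an orbit of characters of degree prime to [p]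
   must have length divisible by [p]. *)
rewrite (partition_big (cfclass_Iirr G) predT) //=; apply: dvdn_sum => C _.
have [t0 /andP[nl0 /eqP defC] | none] := pickP (fun t =>
  ('chi[N]_t \isn't a linear_char) && (cfclass_Iirr G t == C)); last first.
  by rewrite big_pred0.
rewrite (eq_bigl (fun t => t \in C)) => [|t]; last first.
  rewrite -defC eq_cfclass_IirrE andbC; apply: andb_idr.
  rewrite cfclass_IirrE => /cfclassP[y Gy ->].
  by apply: contra nl0 => /(cfConjg_lin_char y^-1); rewrite cfConjgK.
rewrite (eq_bigr (fun=> d t0 ^ 2)%N) => [|t]; last first.
  rewrite -defC cfclass_IirrE => /cfclassP[y Gy def_t].
  by rewrite /d def_t cfConjg1.
rewrite sum_nat_const -defC card_cfclass_Iirr //.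
have [pd | p'd] := boolP (p %| d t0)%N; first by rewrite dvdn_mull // dvdn_exp.
apply: dvdn_mulr.
have pI : p.-nat #|G : 'I_G['chi_t0]|%g.
  by apply: pnat_dvd pGN; rewrite indexgS ?sub_Inertia.
have [//|] := boolP (p %| _)%N; rewrite -p'natE // => p'I.
have I1 : #|G : 'I_G['chi_t0]|%g = 1%N by apply: pnat_1 pI p'I.
have IG : G \subset 'I['chi_t0]%g.
  have : 'I_G['chi_t0]%g = G.
    by apply/eqP; rewrite eqEsubset subsetIl -indexg_eq1 I1 eqxx.
  by move=> <-; apply: subsetIr.
have co : coprime #|G : N|%g ('o('chi_t0)%CF * d t0).
  apply: (pnat_coprime pGN); rewrite pnatM.
  rewrite [X in _ && X]p'natE // p'd andbT.
  exact: p'elt_gen_lin_char_order genN (cfDet_lin_char _).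
have [c [Rc _ _]] := extend_solvable_coprime_irr nsNG solGN IG co.
have c1 : 'chi_c 1%g = 'chi_t0 1%g by rewrite -Rc cfRes1.
case/negP: p'd; rewrite /d -c1; apply: pG; rewrite c1.
by move: nl0; rewrite lin1 -irr1_natr pnatr_eq1.
Qed.

Lemma inertia_aut (gT : finGroupType) (H : {group gT}) (u : {rmorphism algC -> algC})
    (phi : 'CF(H)) : 'I[cfAut u phi]%g = 'I[phi]%g.
Proof.
apply/setP=> y; rewrite !inE; apply: andb_id2l => nHy.
by rewrite -cfAutConjg (inj_eq (@cfAut_inj _ _ _)).
Qed.

(* If c is the canonical extension of theta = 'chi_t to its inertia group T,
   all Ind (c * mu), mu a linear character of the p-group T / N, have the same
   degree; a Galois conjugate of Ind c lying over theta is Ind c itself. *)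
Lemma GCstar_inertia (gT : finGroupType) (G N : {group gT}) (p : nat) (t : Iirr N) :
    GCstar G -> (N <| G)%g -> p^'.-Hall(G) N -> 'chi_t 1%g != 1 ->
  'I_G['chi_t]%g = N.
Proof.
move=> gcG nsNG hallN nl_t; have [sNG nNG] := andP nsNG; have [_ p'N pGN] := and3P hallN.
rewrite pnatNK in pGN.
set T := 'I_G['chi_t]%G; have nsNT : (N <| T)%g by apply: normal_Inertia.
have sTG : T \subset G by apply: Inertia_sub.
have pTN : p.-group (T / N).
  rewrite /pgroup card_quotient ?normal_norm //.
  by rewrite (pnat_dvd _ pGN) // -(Lagrange_index sTG (normal_sub nsNT)) dvdn_mull.
apply/eqP; rewrite eqEsubset (normal_sub nsNT) andbT -quotient_sub1 ?normal_norm //.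
apply: contraT => ntTN; rewrite subG1 in ntTN.
have co : coprime #|T : N|%g ('o('chi_t)%CF * Num.truncn ('chi_t 1%g)).
  rewrite -card_quotient ?normal_norm // (pnat_coprime pTN) // pnatM.
  by rewrite (pnat_dvd (cfDet_order_dvdG _) p'N) (pnat_dvd (irr1_dvdn t) p'N).
(* [c] is the only extension to [T] whose determinantal order is prime to |T : N|. *)
have [c [Rc oc uniq_c]] := extend_solvable_coprime_irr nsNT (pgroup_sol pTN) (subsetIr _ _) co.
have [b lin_b nz_b] : exists2 b : Iirr (T / N), 'chi_b \is a linear_char & b != 0.
  have ltT' := sol_der1_proper (pgroup_sol pTN) (subxx _) ntTN.
  have : (1 < #|T / N : (T / N)^`(1)|%g)%N by rewrite indexg_gt1 proper_subn.
  rewrite -card_lin_irr => /card_gt1P[b1 [b2 [lb1 lb2 nb]]].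
  have [b10 | nz] := eqVneq b1 0; last by exists b1.
  by exists b2; rewrite // eq_sym -b10.
have [irrM inj_mul codom_mul _] := constt_Ind_ext nsNT Rc.
pose s0 := mul_mod_Iirr c (0 : Iirr (T / N)); pose s1 := mul_mod_Iirr c b.
have s0E : 'chi_s0 = 'chi_c.
  by rewrite /s0 /mul_mod_Iirr cfIirrE mod_Iirr0 irr0 mul1r ?mem_irr.
have s1E : 'chi_s1 = 'chi_(mod_Iirr b) * 'chi_c by rewrite cfIirrE.
have ne_s : s0 != s1 by rewrite (inj_eq inj_mul) eq_sym.
have [irrI injI imI _ _] := constt_Inertia_bijection t nsNG.
have A0 : s0 \in irr_constt ('Ind[T] 'chi_t) by rewrite codom_mul codom_f.
have A1 : s1 \in irr_constt ('Ind[T] 'chi_t) by rewrite codom_mul codom_f.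
pose i := Ind_Iirr G s0; pose j := Ind_Iirr G s1.
have iE : 'chi_i = 'Ind[G] 'chi_c by rewrite /i cfIirrE ?irrI // s0E.
have jE : 'chi_j = 'Ind[G] 'chi_s1 by rewrite /j cfIirrE ?irrI.
have ne_ij : i != j by apply: contra ne_s => /eqP/injI->.
have eq1 : 'chi_i 1%g = 'chi_j 1%g.
  rewrite iE jE !cfInd1 // s1E cfunE mod_IirrE ?normal_norm //.
  by rewrite cfMod1 (lin_char1 lin_b) mul1r.
have nl_i : 'chi_i 1%g != 1.
  have c1 : 'chi_c 1%g = 'chi_t 1%g by rewrite -Rc cfRes1.
  rewrite iE cfInd1 // c1 -irr1_natr -natrM pnatr_eq1 muln_eq1 negb_and.
  by rewrite -(pnatr_eq1 algC (Num.truncn _)) irr1_natr nl_t orbT.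
have [||u def_u] := gcG i j nl_i; rewrite -?eq1 //.
have over_i : t \in irr_constt ('Res[N] 'chi_i).
  by rewrite -constt_Ind_Res -imI imset_f.
have over_j : t \in irr_constt ('Res[N] 'chi_j).
  by rewrite -constt_Ind_Res -imI imset_f.
(* The [u]-image of 'chi_t lies under 'chi_j, as 'chi_t does, so Clifford's theorem makes them
   conjugate in [G]. *)
have [y Gy def_y] : exists2 y, y \in G & cfAut u 'chi_t = ('chi_t ^ y)%CF.
  apply/cfclassP; apply: contraR over_i => not_cl.
  rewrite -(fmorph_eq0 u) -cfdot_aut_irr cfAutRes def_u.
  rewrite (Clifford_Res_sum_cfclass nsNG over_j) cfdotZl cfdot_suml big1_seq ?mulr0 //.
  move=> phi /= /cfclassP[y Gy def_phi].
  rewrite def_phi -conjg_IirrE -aut_IirrE cfdot_irr; case: eqP => // eq_t.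
  case/negP: not_cl; rewrite -aut_IirrE -eq_t conjg_IirrE; apply/cfclassP.
  by exists y.
have nNy : y \in 'N(N)%g by apply: (subsetP nNG).
have nTy : y \in 'N(T)%g.
  by apply/normP; rewrite /= conjIg (conjGid Gy) conjg_inertia // -def_y inertia_aut.
(* Undoing [y] after [u] yields another extension of 'chi_t with the determinantal order of [c],
   hence [c] itself; inducing to [G] gives 'chi_j = 'chi_i. *)
have /irrP[d def_d] : (cfAut u 'chi_c ^ y^-1)%CF \in irr T by rewrite cfConjg_irr ?cfAut_irr ?mem_irr.
have eq_dc : d = c.
  apply: uniq_c; rewrite -def_d.
    by rewrite -cfConjgRes_norm ?groupV // -cfAutRes Rc def_y cfConjgK.
  rewrite cfDet_order_conjg ?groupV // cfDet_order_aut ?irr_char // oc.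
  by rewrite coprimeMr in co; case/andP: co.
case/eqP: ne_ij; apply: irr_inj; rewrite -def_u iE cfAutInd.
rewrite -[cfAut u _](cfConjgKV y) def_d eq_dc -cfConjgInd_norm ?(subsetP (normG G)) //.
by rewrite cfConjg_id.
Qed.

(* All nonlinear irreducible characters of B = N<g> vanish at g, hence the
   class of g in B is the whole coset g B'. *)
Lemma noninvariant_cent_der1 (gT : finGroupType) (N : {group gT}) (g : gT) :
    prime #[g]%g -> g \in 'N(N)%g -> coprime #[g]%g #|N| ->
    (forall t : Iirr N, 'chi_t 1%g != 1 -> ('chi_t ^ g)%CF != 'chi_t) ->
  'C_(N^`(1))(<[g]>)%g = 1%g.
Proof.
move=> prg nNg cogN ninv; set B := (N <*> <[g]>)%G.
have ngN : <[g]> \subset 'N(N)%g by rewrite cycle_subG.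
have tiNg : (N :&: <[g]> = 1)%g by rewrite setIC coprime_TIg.
have nsNB : (N <| B)%g by rewrite /normal joing_subl join_subG normG.
have Bg : g \in B by rewrite (subsetP (joing_subr _ _)) ?cycle_id.
have iBN : #|B : N|%g = #[g]%g.
  by rewrite -divgS ?normal_sub //= norm_joinEr // TI_cardMg // mulKn.
have notNg : g \notin N.
  apply: contraL prg => Ng; have : g \in (N :&: <[g]>)%g by rewrite inE Ng cycle_id.
  by rewrite tiNg => /set1P ->; rewrite order1.
(* A nonlinear character of [B] cannot restrict irreducibly to [N], for the restriction would be
   nonlinear and [g]-invariant. It therefore splits into #[g] distinct constituents, and its whole
   norm is already carried by [N]. *)
have vanish (s : Iirr B) : 'chi_s g * ('chi_s g)^* = ('chi_s \is a linear_char)%:R.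
  have [lin_s | nl_s] := boolP ('chi_s \is a linear_char).
    by rewrite -normCK normC_lin_char ?expr1n.
  have [/irrP[t def_t] | [c inj_c Rs]] := cfRes_prime_irr_cases s nsNB iBN prg.
    have inv_t : ('chi_t ^ g)%CF = 'chi_t.
      by rewrite -def_t cfConjgRes_norm ?cfConjg_id // (subsetP (normG B)).
    case/negP: nl_s; rewrite qualifE /= irr_char /=.
    have -> : 'chi_s 1%g = 'chi_t 1%g by rewrite -def_t cfRes1.
    by apply: contraT => /ninv; rewrite inv_t eqxx.
  have norm_R : '['Res[N] 'chi_s] = #[g]%:R.
    rewrite Rs cfdot_suml (eq_bigr (fun=> 1)) ?sumr_const ?card_ord // => k _.
    rewrite cfdot_sumr (bigD1 k) //= cfnorm_irr big1 ?addr0 // => l ne_lk.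
    by rewrite cfdot_irr (inj_eq inj_c) eq_sym (negPf ne_lk).
  have := cfnorm_irr s; rewrite cfdotE (big_setID N) /=.
  rewrite (setIidPr (normal_sub nsNB)).
  have -> : \sum_(x in N) 'chi_s x * ('chi_s x)^* = #|B|%:R.
    rewrite -(Lagrange (normal_sub nsNB)) iBN natrM -norm_R cfdotE mulVKf ?neq0CG //.
    by apply: eq_bigr => x Nx; rewrite cfResE ?(normal_sub nsNB).
  rewrite mulrDr mulVf ?neq0CG // => /(canRL (addKr _)); rewrite addNr => /eqP.
  rewrite mulf_eq0 invr_eq0 (negPf (neq0CG B)) /= psumr_eq0 => [|x _]; last exact: mul_conjC_ge0.
  by move/allP/(_ g (mem_index_enum _)); rewrite inE notNg Bg => /eqP.
have oC : #|'C_B[g]|%g = #|B : B^`(1)|%g.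
  apply/eqP; rewrite -(eqr_nat algC) -card_lin_irr.
  have := second_orthogonality_relation g Bg; rewrite class_refl mulr1n => <-.
  apply/eqP; rewrite -sum1_card natr_sum [RHS]big_mkcond /=.
  by apply: eq_bigr => s _; rewrite vanish inE; case: ifP.
have defcl : (g ^: B = g *: B^`(1))%g.
  apply/eqP; rewrite eqEcard; apply/andP; split.
    apply/subsetP=> _ /imsetP[y By ->].
    by rewrite mem_lcoset -commgEl mem_commg.
  rewrite card_lcoset -index_cent1 -divgS ?subsetIl // oC -divgS ?der_sub //.
  by rewrite divnA ?cardSg ?der_sub // mulKn.
apply/trivgP/subsetP=> x /setIP[N'x cgx].
have Nx : x \in N := subsetP (der_sub 1 N) x N'x.
have B'x : x \in (B^`(1))%g by apply: (subsetP (dergS 1 (normal_sub nsNB))).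
have cxg : commute g x by apply/esym/(centP cgx)/cycle_id.
have : (g * x)%g \in (g ^: B)%g by rewrite defcl mem_lcoset mulKg.
case/imsetP=> y By def_gx.
(* [g * x] is conjugate to [g], while its order is the product of the coprime orders of [g] and [x];
   so [x] is trivial. *)
have cogx : coprime #[g]%g #[x]%g by apply: coprime_dvdr cogN; apply: order_dvdG.
have := orderM cxg cogx; rewrite def_gx orderJ => /eqP.
rewrite -{1}[#[g]%g]muln1 eqn_pmul2l ?order_gt0 // eq_sym order_eq1 => /eqP ->.
exact: set11.
Qed.

End GaloisConjugateCharacters.

Theorem theorem3p9 (gT : finGroupType) (G : {group gT}) :
  ~~ solvable G -> GCstar G -> G^`(1)%g = G.
Proof.
move=> nsolG gcG; apply/eqP; rewrite eqEsubset der_sub -indexg_eq1.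
apply: contraNT nsolG => ntG'; pose p := pdiv #|G : G^`(1)|%g.
have p_pr : prime p by rewrite pdiv_prime // ltn_neqAle eq_sym ntG' indexg_gt0.
have pG' : (p %| #|G : G^`(1)|%g)%N by apply: pdiv_dvd.
have hallN := dvd_irr1_p_nilpotent p_pr (fun i => GCstar_dvd_irr1 gcG p_pr pG').
set N := 'O_p^'(G)%G in hallN; have nsNG : (N <| G)%g by apply: pcore_normal.
have [sNG nNG] := andP nsNG; have [_ p'N pGN] := and3P hallN.
have pG : (p %| #|G|)%N by apply: dvdn_trans pG' (dvdn_indexg _ _).
have [g Gg og] := Cauchy p_pr pG.
have nNg : g \in 'N(N)%g by apply: (subsetP nNG).
have cogN : coprime #[g]%g #|N| by rewrite og prime_coprime // -p'natE.
(* An invariant nonlinear character would put [g], of order [p], into its inertia group, which is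
   the [p']-group [N]. *)
have ninv (t : Iirr N) : ('chi_t 1%g != 1 -> ('chi_t ^ g)%CF != 'chi_t)%R.
  move=> nl_t; apply: contraL cogN => /eqP inv_t.
  have : (g \in 'I_G['chi_t])%R by rewrite in_setI Gg; apply/setIdP; rewrite inv_t eqxx.
  rewrite (GCstar_inertia gcG nsNG hallN nl_t) => Ng.
  by rewrite og prime_coprime // negbK -og order_dvdG.
have prg : prime #[g]%g by rewrite og.
have C1 := noninvariant_cent_der1 prg nNg cogN ninv.
have nilN' : nilpotent N^`(1)%g.
  apply: (@fpf_prime_nilpotent _ <[g]>%G) => //.
  by apply: gFnorm_trans; rewrite cycle_subG.
have solN : solvable N.
  by rewrite (series_sol (der_normal 1 N)) (nilpotent_sol nilN') abelian_sol ?der_abelian.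
rewrite (series_sol nsNG) solN; apply: (@pgroup_sol _ p).
by rewrite /pgroup card_quotient // -pnatNK.
Qed.
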